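(* Let $(X,d,\mathfrak m)$ be a locally compact metric measure space, let $K\in\mathbb R$, and let $(d_n)_{n\in\mathbb N}$ be a sequence of distances on $X$, inducing the same topology as $d$, locally uniformly convergent to $d$ as $n\to\infty$, such that there exists a constant $H$ with $$d_n(x,y)\le H\,d(x,y)\qquad\text{for every }x,y\in X\text{ and every }n.$$ Assume that there exists a map $G:X\times X\to C([0,1],X)$ which is a Lipschitz consistent geodesic flow for $d$ and a consistent geodesic flow for every distance $d_n$. Moreover, suppose that there is a consistent plan selection $\Pi$ on $(X,d,\mathfrak m)$, associated to $G$, such that for every $\mu,\nu\in\mathscr P_{ac}(X)$ there exists a sequence $\pi_n\in\mathrm{OptPlans}_{d_n}(\mu,\nu)$ satisfying: 1. $\pi_n\rightharpoonup\Pi(\mu,\nu)$ weakly, up to the extraction of a subsequence; 2. the $K$-convexity of the entropy holds along the $d_n$-Wasserstein geodesic $G_\#\pi_n$ with respect to $d_n$, i.e. for every $t\in[0,1]$ $$\mathrm{Ent}\big((G_t)_\#\pi_n\big)\le(1-t)\,\mathrm{Ent}(\mu)+t\,\mathrm{Ent}(\nu)-\frac K2\,t(1-t)\,\big(W_2^{d_n}\big)^2(\mu,\nu).$$ Then $(X,d,\mathfrak m)$ is a very strict $\mathsf{CD}(K,\infty)$ space.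
   Context: A metric measure space is a triple $(X,d,\mathfrak m)$ with $(X,d)$ a Polish metric space and $\mathfrak m$ a non-negative, non-null Borel measure finite on bounded sets; it is assumed throughout that $\int e^{-c\,d^2(x,x_0)}\,d\mathfrak m(x)<\infty$ for some (and thus all) $x_0\in X$ and a suitable $c>0$. $\mathscr P_2(X)$: Borel probability measures with finite second moment with respect to $d$; $\mathscr P_{ac}(X)$: those in $\mathscr P_2(X)$ absolutely continuous with respect to $\mathfrak m$. $\mathrm{OptPlans}(\mu,\nu)$: couplings of $\mu,\nu$ minimizing $\int d^2\,d\pi$; $W_2^2(\mu,\nu)$ is the minimum value; $\mathrm{OptPlans}_{d_n}$ and $W_2^{d_n}$ are the same objects for the distance $d_n$. $\mathrm{Ent}(\mu)=\int\rho\log\rho\,d\mathfrak m$ if $\mu=\rho\mathfrak m$, and $+\infty$ if $\mu\not\ll\mathfrak m$. $\mathrm{Geo}(X)\subset C([0,1],X)$: constant speed geodesics; $e_t(\gamma)=\gamma(t)$; $(\mathrm{restr}_s^t\gamma)(r)=\gamma((1-r)s+rt)$. $\mathrm{OptGeo}(\mu,\nu)$: probability measures $\eta$ on $C([0,1],X)$ concentrated on $\mathrm{Geo}(X)$ with $(e_0,e_1)_\#\eta\in\mathrm{OptPlans}(\mu,\nu)$. Very strict $\mathsf{CD}(K,\infty)$: for all $\mu_0,\mu_1\in\mathscr P_{ac}(X)$ there is $\eta\in\mathrm{OptGeo}(\mu_0,\mu_1)$ such that for all $t_0<t_1$ in $[0,1]$ and all bounded Borel $f:\mathrm{Geo}(X)\to[0,\infty)$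 with $\int f\,d\eta=1$, setting $\sigma=(\mathrm{restr}_{t_0}^{t_1})_\#(f\eta)$ and $\sigma_t=(e_t)_\#\sigma$, one has $\mathrm{Ent}(\sigma_t)\le(1-t)\mathrm{Ent}(\sigma_0)+t\,\mathrm{Ent}(\sigma_1)-\frac K2t(1-t)W_2^2(\sigma_0,\sigma_1)$ for all $t\in[0,1]$. Consistent geodesic flow for $(X,d)$: a measurable map $G:X\times X\to C([0,1],X)$ such that 1) for every $x,y\in X$, $G(x,y)\in\mathrm{Geo}(X)$ with $G(x,y)(0)=x$, $G(x,y)(1)=y$; 2) $\mathrm{restr}_s^t\,G(x,y)=G\big(G(x,y)(s),G(x,y)(t)\big)$ for every $s<t$ in $(0,1)$ and $x,y\in X$. It is Lipschitz if for some $L$, $\sup_{t\in[0,1]}d(G(x_1,y_1)(t),G(x_2,y_2)(t))\le L(d^2(x_1,x_2)+d^2(y_1,y_2))^{1/2}$ for all $x_i,y_i\in X$. Write $G_r:=e_r\circ G$. Consistent plan selection associated to $G$: a map $\Pi:\mathscr P_{ac}(X)\times\mathscr P_{ac}(X)\to\mathscr P(X\times X)$ such that 1) $\Pi(\mu,\nu)\in\mathrm{OptPlans}(\mu,\nu)$ for all $\mu,\nu\in\mathscr P_{ac}(X)$; 2) for all $\mu,\nu\in\mathscr P_{ac}(X)$, $s<t$ in $[0,1]$ and bounded Borel $f:X\times X\to[0,\infty)$ with $\int f\,d\Pi(\mu,\nu)=1$, if $(G_s)_\#(f\cdot\Pi(\mu,\nu)),(G_t)_\#(f\cdot\Pi(\mu,\nu))\in\mathscr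 P_{ac}(X)$, then $(G_s,G_t)_\#(f\cdot\Pi(\mu,\nu))=\Pi\big((G_s)_\#(f\cdot\Pi(\mu,\nu)),(G_t)_\#(f\cdot\Pi(\mu,\nu))\big)$. *)

(* Defs.v *)
From HB Require Import structures.
From mathcomp Require Import all_boot all_order all_algebra.
From mathcomp Require Import all_classical all_reals all_analysis.
Set Implicit Arguments.
Unset Strict Implicit.
Unset Printing Implicit Defensive.
Import Order.TTheory GRing.Theory Num.Theory.
Import numFieldNormedType.Exports.

Local Open Scope classical_set_scope.
Local Open Scope ring_scope.

#[short(type="completeMetricType")]
HB.structure Definition CompleteMetric (R : numDomainType) :=
  {T of Metric R T & Complete T}.

Definition separable (T : topologicalType) : Prop :=
  exists2 D : set T, countable D & dense D.

Notation borel T := (g_sigma_algebraType (@open T)).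

HB.instance Definition _ (S T : ptopologicalType) := Pointed.on (S * T)%type.

Section unit_interval.
Context {R : realType}.

Definition I01 : Type := set_type (`[0, 1]%classic : set R).

HB.instance Definition _ :=
  Topological.copy I01 (set_type (`[0, 1]%classic : set R)).

Lemma I01_bounds (t : I01) : 0 <= \val t <= 1.
Proof. by have := set_valP t; rewrite /= in_itv. Qed.

Lemma zero_subproof : (0 : R) \in (`[0, 1]%classic : set R).
Proof. by rewrite mem_set//= in_itv/= lexx ler01. Qed.

Lemma one_subproof : (1 : R) \in (`[0, 1]%classic : set R).
Proof. by rewrite mem_set//= in_itv/= lexx ler01. Qed.

Definition I01_0 : I01 := exist _ 0 zero_subproof.
Definition I01_1 : I01 := exist _ 1 one_subproof.

Lemma affine_subproof (s t r : I01) :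
  (1 - \val r) * \val s + \val r * \val t \in (`[0, 1]%classic : set R).
Proof.
have /andP[s0 s1] := I01_bounds s; have /andP[t0 t1] := I01_bounds t.
have /andP[r0 r1] := I01_bounds r.
have r1' : 0 <= 1 - \val r by rewrite subr_ge0.
rewrite mem_set//= in_itv/= addr_ge0 ?mulr_ge0//=.
by rewrite -[leRHS](subrK (\val r)) lerD// ler_piMr.
Qed.

Definition affine (s t r : I01) : I01 :=
  exist _ ((1 - \val r) * \val s + \val r * \val t) (affine_subproof s t r).

Lemma affine_continuous (s t : I01) : continuous (affine s t).
Proof.
have ch : continuous (fun x : R => (1 - x) * \val s + x * \val t).
  move=> x; apply: (@cvgD R R^o); apply: cvgM; do ?exact: cvg_cst.
    by apply: (@cvgB R R^o); [exact: cvg_cst|exact: cvg_id].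
  exact: cvg_id.
apply: continuous_comp_initial => r.
have cv : {for r, continuous (\val : I01 -> R)} by exact: initial_continuous.
exact: (continuous_comp cv (ch _)).
Qed.

HB.instance Definition _ (s t : I01) :=
  isContinuous.Build I01 I01 (affine s t) (@affine_continuous s t).

End unit_interval.
Arguments I01 R : clear implicits.

(* The compact-open topology on C([0, 1], X) is the topology of the sup
   distance, for any distance metrizing X. *)
Definition C01 (R : realType) (X : ptopologicalType) : Type :=
  continuousType (I01 R) X.

HB.instance Definition _ (R : realType) (X : ptopologicalType) :=
  Choice.copy (C01 R X) (continuousType (I01 R) X).
HB.instance Definition _ (R : realType) (X : ptopologicalType) :=
  Topological.copy (C01 R X) (initial_topology
    (fun g : C01 R X => (g : continuousType (I01 R) X) : {compact-open, I01 R -> X})).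
HB.instance Definition _ (R : realType) (X : ptopologicalType) :=
  isPointed.Build (C01 R X) (mkcts (@cst_continuous (I01 R) X point)).

Section paths.
Context {R : realType} {X : ptopologicalType}.
Implicit Types (dist : X -> X -> R) (g : C01 R X).

Definition e_ (t : I01 R) g : X := (g : continuousType (I01 R) X) t.

Definition restr (s t : I01 R) g : C01 R X :=
  (g : continuousType (I01 R) X) \o affine s t.

Definition Geo dist : set (C01 R X) :=
  [set g | forall s t : I01 R,
    dist (e_ s g) (e_ t g) =
      `|\val s - \val t| * dist (e_ I01_0 g) (e_ I01_1 g)].

End paths.

Section measures.
Context {R : realType}.
Local Open Scope ereal_scope.

Definition push (S T : ptopologicalType) (mu : set (borel S) -> \bar R)
    (f : S -> T) : set (borel T) -> \bar R :=
  pushforward mu (f : borel S -> borel T).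

(* The measure f . mu, for f defined on D. *)
Definition weighted (T : ptopologicalType) (mu : set (borel T) -> \bar R)
    (D : set (borel T)) (f : borel T -> R) : set (borel T) -> \bar R :=
  fun A => \int[mu]_(x in A `&` D) (f x)%:E.

(* Set functions carry irrelevant values on non-measurable sets. *)
Definition same_measure (T : ptopologicalType)
    (mu nu : set (borel T) -> \bar R) : Prop :=
  forall A, measurable A -> mu A = nu A.

Definition weakly_cvg (T : ptopologicalType)
    (mu : nat -> set (borel T) -> \bar R) (nu : set (borel T) -> \bar R) :=
  forall f : T -> R, continuous f -> (exists M, forall x, `|f x| <= M)%R ->
    \int[mu n]_(x in [set: borel T]) (f x)%:E @[n --> \oo] -->
    \int[nu]_(x in [set: borel T]) (f x)%:E.

End measures.

Section distances.
Context {R : realType} {X : ptopologicalType}.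

Definition is_distance (dist : X -> X -> R) : Prop :=
  [/\ forall x y, 0 <= dist x y,
      forall x y, dist x y = 0 <-> x = y,
      forall x y, dist x y = dist y x &
      forall x y z, dist x z <= dist x y + dist y z].

Definition metrizes (dist : X -> X -> R) : Prop :=
  forall x, nbhs x = nbhs_ball_ (fun y r => [set z | dist y z < r]) x.

Definition locally_uniformly_cvg (dist_ : nat -> X -> X -> R)
    (dist : X -> X -> R) : Prop :=
  forall p : X * X, exists2 U : set (X * X), nbhs p U &
    {uniform U, (fun n q => dist_ n q.1 q.2) n @[n --> \oo] -->
                (fun q => dist q.1 q.2)}.

End distances.

Section optimal_transport.
Context {R : realType} {X : ptopologicalType}.
Local Open Scope ereal_scope.
Variable dist : X -> X -> R.
Implicit Types mu nu : set (borel X) -> \bar R.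
Implicit Types pi : set (borel (X * X)%type) -> \bar R.

Definition coupling mu nu pi : Prop :=
  same_measure (push pi fst) mu /\ same_measure (push pi snd) nu.

Definition cost pi : \bar R :=
  \int[pi]_(p in [set: borel (X * X)%type]) ((dist p.1 p.2) ^+ 2)%:E.

Definition OptPlans mu nu pi : Prop :=
  coupling mu nu pi /\
  forall pi' : probability (borel (X * X)%type) R,
    coupling mu nu pi' -> cost pi <= cost pi'.

Definition W2sq mu nu : \bar R :=
  ereal_inf [set cost pi | pi in
    [set pi : probability (borel (X * X)%type) R | coupling mu nu pi]].

Definition OptGeo mu nu (eta : probability (borel (C01 R X)) R) : Prop :=
  {ae eta, forall g, Geo dist g} /\
  OptPlans mu nu (push eta (fun g : C01 R X => (e_ I01_0 g, e_ I01_1 g))).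

Definition P2 (mu : probability (borel X) R) : Prop :=
  exists x0 : X, \int[mu]_(x in [set: borel X]) ((dist x x0) ^+ 2)%:E < +oo.

Definition Pac (m : {measure set (borel X) -> \bar R})
    (mu : probability (borel X) R) : Prop :=
  P2 mu /\ mu `<< m.

End optimal_transport.

Section entropy.
Context {R : realType} {X : ptopologicalType}.
Local Open Scope ereal_scope.
Variable m : {measure set (borel X) -> \bar R}.

Definition is_density (mu : set (borel X) -> \bar R) (rho : borel X -> R) :=
  [/\ measurable_fun [set: borel X] rho,
      forall x, (0 <= rho x)%R &
      same_measure mu (weighted m [set: borel X] rho)].

(* By the Radon-Nikodym theorem, for a probability mu and a sigma-finite m
   there is a density if and only if mu `<< m. Recall that ln 0 = 0. *)
Definition Ent (mu : set (borel X) -> \bar R) : \bar R :=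
  match pselect (exists rho, is_density mu rho) with
  | left mu_rho => let rho := projT1 (cid mu_rho) in
      \int[m]_(x in [set: borel X]) (rho x * ln (rho x))%:E
  | right _ => +oo
  end.

End entropy.

Section convexity.
Context {R : realType} {X : ptopologicalType}.
Local Open Scope ereal_scope.

Definition very_strict_CD (dist : X -> X -> R)
    (m : {measure set (borel X) -> \bar R}) (K : R) : Prop :=
  forall mu0 mu1 : probability (borel X) R,
    Pac dist m mu0 -> Pac dist m mu1 ->
  exists2 eta : probability (borel (C01 R X)) R, OptGeo dist mu0 mu1 eta &
    forall t0 t1 : I01 R, (\val t0 < \val t1)%R ->
    forall f : borel (C01 R X) -> R,
      measurable_fun (Geo dist : set (borel (C01 R X))) f ->
      (forall g, Geo dist g -> 0 <= f g)%R ->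
      (exists M, forall g, Geo dist g -> f g <= M)%R ->
      \int[eta]_(g in Geo dist) (f g)%:E = 1 ->
    let sigma := push (weighted eta (Geo dist) f) (restr t0 t1) in
    let sigma_ t := push sigma (e_ t) in
    forall t : I01 R,
      Ent m (sigma_ t) <=
        (1 - \val t)%:E * Ent m (sigma_ I01_0)
        + (\val t)%:E * Ent m (sigma_ I01_1)
        - (K / 2 * \val t * (1 - \val t))%:E
          * W2sq dist (sigma_ I01_0) (sigma_ I01_1).

End convexity.

Section selections.
Context {R : realType} {X : ptopologicalType}.
Local Open Scope ereal_scope.
Variable dist : X -> X -> R.
Implicit Type G : X * X -> C01 R X.

Definition consistent_geodesic_flow G : Prop :=
  [/\ measurable_fun [set: borel (X * X)%type]
        (G : borel (X * X)%type -> borel (C01 R X)),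
      forall x y, [/\ Geo dist (G (x, y)),
        e_ I01_0 (G (x, y)) = x & e_ I01_1 (G (x, y)) = y] &
      forall s t : I01 R, (0 < \val s)%R -> (\val s < \val t)%R ->
        (\val t < 1)%R -> forall x y,
        restr s t (G (x, y)) = G (e_ s (G (x, y)), e_ t (G (x, y)))].

Definition Lipschitz_flow G : Prop :=
  exists L : R, forall (x1 x2 y1 y2 : X) (t : I01 R),
    (dist (e_ t (G (x1, y1))) (e_ t (G (x2, y2)))
      <= L * Num.sqrt ((dist x1 x2) ^+ 2 + (dist y1 y2) ^+ 2))%R.

(* Pi is a total function; only its values on pairs of measures in Pac are
   constrained. In the second condition mu' and nu' range over all the
   probability measures representing the two push-forwards. *)
Definition consistent_plan_selection
    (m : {measure set (borel X) -> \bar R}) G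
    (Pi : probability (borel X) R -> probability (borel X) R ->
          probability (borel (X * X)%type) R) : Prop :=
  (forall mu nu, Pac dist m mu -> Pac dist m nu ->
    OptPlans dist mu nu (Pi mu nu)) /\
  (forall mu nu, Pac dist m mu -> Pac dist m nu ->
    forall s t : I01 R, (\val s < \val t)%R ->
    forall f : borel (X * X)%type -> R,
      measurable_fun [set: borel (X * X)%type] f ->
      (forall p, 0 <= f p)%R -> (exists M, forall p, f p <= M)%R ->
      \int[Pi mu nu]_(p in [set: borel (X * X)%type]) (f p)%:E = 1 ->
    let fPi := weighted (Pi mu nu) [set: borel (X * X)%type] f in
    forall mu' nu' : probability (borel X) R,
      same_measure mu' (push fPi (e_ s \o G)) ->
      same_measure nu' (push fPi (e_ t \o G)) ->
      Pac dist m mu' -> Pac dist m nu' ->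
      same_measure (push fPi (fun p => (e_ s (G p), e_ t (G p))))
        (Pi mu' nu')).

End selections.

Definition metric_measure_space (R : realType) (X : completeMetricType R)
    (m : {measure set (borel X) -> \bar R}) : Prop :=
  [/\ separable X,
      (0 < m [set: borel X])%E,
      forall A : set (borel X), measurable A ->
        (exists (x : X) (r : R), A `<=` ball x r) -> (m A < +oo)%E &
      exists (x0 : X) (c : R), 0 < c /\
        (\int[m]_(x in [set: borel X])
          (expR (- c * mdist (x : X) x0 ^+ 2))%:E < +oo)%E].

(* Main.v *)
From HB Require Import structures.
Require Import Defs.
From mathcomp Require Import all_boot all_order all_algebra.
From mathcomp Require Import all_classical all_reals all_analysis.
From mathcomp Require Import measurable_realfun ring lra.
Import Order.TTheory GRing.Theory Num.Theory.
Import numFieldNormedType.Exports.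

(** Fix [mu0, mu1] in [Pac] and put [eta := G_# Pi mu0 mu1]; this is an optimal
    geodesic plan because [Pi mu0 mu1] is an optimal plan.  Restricting [eta] to
    a time interval [[t0, t1]] and weighting it with [f] gives a measure on paths
    whose marginal at time [r] is
    [(G_((1-r) t0 + r t1))_# (fG . Pi mu0 mu1)], where [fG := f \o G].  Let
    [mu, nu] be the end marginals ([r = 0] and [r = 1]).  If one of them has
    infinite entropy then the right-hand side of the convexity inequality is
    [+oo], since entropies of measures of finite second moment are [> -oo] and
    [W_2(mu, nu)] is finite.  Otherwise [mu] and [nu] are in [Pac], the
    consistency of [Pi] says that [(G_t0, G_t1)_# (fG . Pi mu0 mu1)] is
    [Pi mu nu], and the consistency of [G] that the marginal at time [r] is
    [(G_r)_# Pi mu nu] ([restricted_entropy_convexity]).  It remains to let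
    [n] tend to infinity in the convexity inequalities that hold along the
    approximating plans [pi_ n] between [mu] and [nu]
    ([Ent_interpolation_limit]).  This limit has two ingredients.

    Lower semicontinuity of the entropy ([Ent_push_limit]).  The reference
    measure [m] is only assumed to make [exp(- V)] integrable for
    [V := c d(., x0)^2], so one works with the Legendre duality
      [Ent mu = sup_psi (int psi dmu - int V dmu - int exp(psi - V - 1) dm)],
    for [mu] of finite second moment, where [psi] ranges over the bounded
    continuous functions ([integral_le_Ent], [Ent_le]).  Under weak convergence
    the term [int psi dmu] converges, but [int V dmu] could jump down in the
    limit.  It does not because all plans have the same marginals: [V \o G_t] is
    dominated by a sum [a(x) + b(y)] of integrable functions of the end points,
    whose integral is the same for all couplings, and lower semicontinuity
    applied to [a(x) + b(y) - V (G_t (x, y)) >= 0] yields upper semicontinuity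
    of [int V dmu].

    Convergence of the costs ([W2sq_cvg]).  The plan [Pi mu nu] is a competitor
    for every [d_ n], and its [d_ n]-cost tends to its [d]-cost by dominated
    convergence, as [d_ n <= H d]; this bounds the upper limit.  The lower limit
    is bounded with a version of Fatou's lemma in which both the measures and
    the integrands vary ([weakly_cvg_fatou]); it is proved by approximating the
    integrands from below with their Lipschitz regularizations. *)

Set Implicit Arguments.
Unset Strict Implicit.
Unset Printing Implicit Defensive.

Local Open Scope classical_set_scope.
Local Open Scope ring_scope.

(** * Borel measurability of continuous functions *)

Section borel_continuous.
Context {R : realType}.

Lemma continuous_borel_measurable (S T : ptopologicalType) (f : S -> T) :
  continuous f ->
  measurable_fun [set: borel S] (f : borel S -> borel T).
Proof.
move=> cf; apply: (@measurability _ _ (borel S) (borel T) _ _ (@open T)) => //.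
move=> _ [U oU <-]; rewrite setTI; apply: sub_sigma_algebra.
by apply: open_comp => // x _; exact: cf.
Qed.

Lemma continuous_borel_measurableR (S : ptopologicalType) (f : S -> R) :
  continuous f -> measurable_fun [set: borel S] (f : borel S -> R).
Proof.
move=> cf; apply: (measurability _ (RGenOpens.measurableE R)) => //.
move=> _ [_ [a [b ->]] <-]; rewrite setTI; apply: sub_sigma_algebra.
apply: open_comp => [x _|]; first exact: cf.
exact: interval_open.
Qed.

End borel_continuous.

(** * Lipschitz regularization from below *)

Section yosida.
Context {R : realType} {T : ptopologicalType}.
Variable D : T -> T -> R.
Hypothesis D0 : forall p q, 0 <= D p q.
Hypothesis Dxx : forall p, D p p = 0.
Hypothesis Dsym : forall p q, D p q = D q p.
Hypothesis Dtri : forall p q r, D p r <= D p q + D q r.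
Hypothesis Dcont : forall p (e : R), 0 < e -> \forall q \near p, D p q < e.
Variable u_ : nat -> T -> R.
Hypothesis u0 : forall n p, 0 <= u_ n p.

Let S k p := [set r | exists n q, (k <= n)%N /\
  r = Num.min (u_ n q) k%:R + k%:R * D p q].

(** The Moreau-Yosida regularization of [inf_(n >= k) u_ n], truncated at [k]:
    a bounded Lipschitz function that lies below [u_ n] for every [n >= k]. *)
Definition yosida k p : R := inf (S k p).

Let S_ge0 k p r : S k p r -> 0 <= r.
Proof.
by move=> [n [q [_ ->]]]; rewrite addr_ge0 ?mulr_ge0// le_min u0 ler0n.
Qed.

Let S_inf k p : has_inf (S k p).
Proof.
split; last by exists 0 => r /S_ge0.
by exists (Num.min (u_ k p) k%:R + k%:R * D p p), k, p.
Qed.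

Lemma yosida_ge0 k p : 0 <= yosida k p.
Proof. by apply: lb_le_inf; [have [] := S_inf k p | move=> r /S_ge0]. Qed.

Lemma yosida_le_min k p n q : (k <= n)%N ->
  yosida k p <= Num.min (u_ n q) k%:R + k%:R * D p q.
Proof.
by move=> kn; apply: ge_inf; [have [] := S_inf k p | exists n, q].
Qed.

Lemma yosida_le k p n : (k <= n)%N -> yosida k p <= u_ n p.
Proof.
move=> kn; apply: le_trans (yosida_le_min p p kn) _.
by rewrite Dxx mulr0 addr0 ge_min lexx.
Qed.

Lemma yosida_bounded k p : `|yosida k p| <= k%:R.
Proof.
rewrite ger0_norm ?yosida_ge0// (le_trans (yosida_le_min p p (leqnn k)))//.
by rewrite Dxx mulr0 addr0 ge_min lexx orbT.
Qed.

Lemma yosida_lipschitz k p q : yosida k p <= yosida k q + k%:R * D p q.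
Proof.
rewrite -lerBlDr; apply: lb_le_inf; first by have [] := S_inf k q.
move=> _ [n [z [kn ->]]]; rewrite lerBlDr.
rewrite (le_trans (yosida_le_min p z kn))// -addrA lerD2l -mulrDr.
by rewrite ler_wpM2l// addrC.
Qed.

Lemma yosida_continuous k : continuous (yosida k).
Proof.
move=> p; apply/cvgrPdist_lt => e e0.
near=> q.
have H : k%:R * D p q < e.
  have : D p q < e / k.+1%:R by near: q; apply: Dcont; rewrite divr_gt0.
  rewrite ltr_pdivlMr// mulrC; apply: le_lt_trans.
  by rewrite ler_wpM2r// ler_nat.
rewrite (le_lt_trans _ H)// ler_norml; apply/andP; split.
  by rewrite lerNl opprB lerBlDr addrC Dsym yosida_lipschitz.
by rewrite lerBlDr addrC yosida_lipschitz.
Unshelve. all: by end_near. Qed.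

Lemma yosida_nondecreasing p : nondecreasing_seq (yosida ^~ p).
Proof.
move=> k l kl; apply: lb_le_inf; first by have [] := S_inf l p.
move=> _ [n [q [ln ->]]].
apply: (le_trans (yosida_le_min p q (leq_trans kl ln))).
by rewrite lerD ?ler_wpM2r ?ler_nat// le_min !ge_min lexx ler_nat kl orbT.
Qed.

(** The regularizations recover every local lower bound of the sequence: near
    [p] the infimum sees the bound [c], and away from [p] the penalty [k d]
    takes over once [k] is large. *)
Lemma yosida_sup p (c d : R) N : 0 < d ->
  (forall n q, (N <= n)%N -> D p q < d -> c <= u_ n q) ->
  exists k, c <= yosida k p.
Proof.
move=> d0 cu.
have [c0|c0] := leP c 0; first by exists 0%N; rewrite (le_trans c0)// yosida_ge0.
pose k := maxn N (maxn (Num.bound c) (Num.bound (c / d))).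
have Nk : (N <= k)%N by rewrite leq_maxl.
have ck : c <= k%:R.
  rewrite ltW// (lt_le_trans (archi_boundP (ltW c0)))// ler_nat.
  by rewrite /k maxnCA leq_maxl.
have cdk : c <= k%:R * d.
  rewrite -ler_pdivrMr// ltW// (lt_le_trans (archi_boundP _))//.
    by rewrite divr_ge0// ltW.
  by rewrite ler_nat /k !leq_max leqnn !orbT.
exists k; apply: lb_le_inf; first by have [] := S_inf k p.
move=> _ [n [q [kn ->]]].
have [pq|pq] := ltP (D p q) d.
  by rewrite ler_wpDr ?mulr_ge0// le_min ck cu// (leq_trans Nk).
rewrite (le_trans cdk)// ler_wpDl//; first by rewrite le_min u0 ler0n.
by rewrite ler_wpM2l.
Qed.

End yosida.

(** * Fatou's lemma for weakly converging measures *)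

Section weak_lsc.
Context {R : realType} {T : ptopologicalType}.
Variable D : T -> T -> R.
Hypothesis D0 : forall p q, 0 <= D p q.
Hypothesis Dxx : forall p, D p p = 0.
Hypothesis Dsym : forall p q, D p q = D q p.
Hypothesis Dtri : forall p q r, D p r <= D p q + D q r.
Hypothesis Dcont : forall p (e : R), 0 < e -> \forall q \near p, D p q < e.

Let EFin_lt_le (x y : \bar R) : (0 <= x)%E ->
  (forall c : R, (c%:E < x)%E -> (c%:E <= y)%E) -> (x <= y)%E.
Proof.
move=> x0 H; rewrite leNgt; apply/negP => yx.
case: x x0 H yx => [r|_|//]; last first.
  case: y => [s H _|H|H].
  - have := H (s + 1) (ltry _); rewrite lee_fin.
    by lra.
  - by [].
  - by have := H 0 (ltry _); rewrite leeNy_eq.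
case: y => [s|//|] r0 H.
  rewrite lte_fin => sr; have := H ((r + s) / 2).
  by rewrite lte_fin lee_fin => /(_ ltac:(lra)); lra.
move=> _; have := H (r - 1); rewrite lte_fin leeNy_eq => /(_ ltac:(lra)).
by [].
Qed.

(** Both the measures and the integrands may vary; the assumption on [u] says
    that it lies below the Gamma-lower limit of [u_].  The regularization
    [g k] of the sequence is a bounded continuous test function, below [u_ n]
    for [n >= k], so that [int (g k) dpi] bounds the lower limit of
    [int (u_ n) dpi_ n] from below; then [k] tends to infinity by monotone
    convergence. *)
Lemma weakly_cvg_fatou (pi_ : nat -> probability (borel T) R)
    (pi : probability (borel T) R) (u_ : nat -> T -> R) (u : T -> R) :
  weakly_cvg pi_ pi ->
  (forall n p, 0 <= u_ n p) -> (forall p, 0 <= u p) ->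
  (forall n, measurable_fun [set: borel T] (u_ n)) ->
  measurable_fun [set: borel T] u ->
  (forall p (e : R), 0 < e -> exists2 d, 0 < d & exists N, forall n q,
     (N <= n)%N -> D p q < d -> u p - e <= u_ n q) ->
  forall c : R, (c%:E < \int[pi]_(x in [set: borel T]) (u x)%:E)%E ->
  \forall n \near \oo,
    (c%:E < \int[pi_ n]_(x in [set: borel T]) (u_ n x)%:E)%E.
Proof.
move=> cvgpi u_0 u0 mu_ mu ulim c cu.
pose g k := yosida D u_ k.
have mg k : measurable_fun [set: borel T] (EFin \o g k : borel T -> \bar R).
  apply/measurable_EFinP; apply: continuous_borel_measurableR.
  exact: yosida_continuous.
have g0 k (x : borel T) : (0 <= (g k x)%:E)%E by rewrite lee_fin yosida_ge0.
have ndg (x : borel T) : nondecreasing_seq (fun k => (g k x)%:E).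
  by move=> i j ij; rewrite lee_fin yosida_nondecreasing.
have : (c%:E < limn (fun k => \int[pi]_(x in [set: borel T]) (g k x)%:E))%E.
  rewrite -monotone_convergence//.
  apply: (lt_le_trans cu); apply: ge0_le_integral => //.
  - by move=> x _; rewrite lee_fin.
  - exact/measurable_EFinP.
  - apply: (emeasurable_fun_cvg (fun k => EFin \o g k : borel T ->
    \bar R)) => // x _.
    exact: (ereal_nondecreasing_is_cvgn (ndg x)).
  - move=> x _; apply: EFin_lt_le; first by rewrite lee_fin.
    move=> b; rewrite lte_fin => bu.
    have [d d0 [N H]] := ulim x (u x - b) ltac:(lra).
    have [k bk] := @yosida_sup _ _ _ D0 _ u_0 x b d N d0
      ltac:(move=> n q Nn xq; have := H n q Nn xq; lra).
    apply: (@le_trans _ _ (g k x)%:E); first by rewrite lee_fin.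
    apply: lime_ge; first exact: (ereal_nondecreasing_is_cvgn (ndg x)).
    by exists k => // l kl; exact: ndg.
move=> clim.
have [k ck] : exists k, (c%:E < \int[pi]_(x in [set: borel T]) (g k x)%:E)%E.
  apply: contrapT => /forallNP H; move: clim; apply/negP; rewrite -leNgt.
  apply: lime_le.
    apply: ereal_nondecreasing_is_cvgn => k l kl.
    apply: ge0_le_integral => //; [exact: mg|exact: mg|].
    by move=> x _; exact: ndg.
  by apply: nearW => k; rewrite leNgt; apply/negP; exact: H.
have gcv : continuous (g k) by exact: yosida_continuous.
have gbd : exists M, forall x, `|g k x| <= M.
  by exists k%:R => x; exact: yosida_bounded.
have := cvgpi _ gcv gbd => /(_ _ (open_ereal_gt' ck)).
move=> near_c; near=> n.
apply: (@lt_le_trans _ _ (\int[pi_ n]_(x in [set: borel T]) (g k x)%:E)%E).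
  by near: n.
apply: ge0_le_integral => //; [exact: mg|exact/measurable_EFinP|].
move=> x _; rewrite lee_fin yosida_le//.
by near: n; exact: nbhs_infty_ge.
Unshelve. all: by end_near. Qed.

End weak_lsc.

(** * Measures given by densities *)

Section packing.
Context d {T : measurableType d} {R : realType}.
Local Open Scope ereal_scope.

Lemma exists_probability (nu : {measure set T -> \bar R}) :
  nu [set: T] = 1 -> exists P : probability T R, forall A, P A = nu A.
Proof.
move=> nu1; exists (mnormalize nu (dirac point)) => A.
by rewrite /= /mnormalize nu1 onee_eq0 /= invr1 mule1.
Qed.

Lemma exists_finite_measure (nu : {measure set T -> \bar R}) :
  nu [set: T] < +oo ->
  exists P : {finite_measure set T -> \bar R}, forall A, P A = nu A.
Proof.
by move=> nu1; exists (mfrestr measurableT nu1) => A;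
  rewrite /= /mfrestr /mrestr setIT.
Qed.

End packing.

Section weighted_measures.
Context {R : realType} {T : ptopologicalType}.
Local Open Scope ereal_scope.

Variables (mu : {measure set (borel T) -> \bar R}) (f : borel T -> R).
Hypothesis mf : measurable_fun [set: borel T] f.
Hypothesis f0 : forall x, (0 <= f x)%R.

Local Definition weighted_fun := weighted mu [set: borel T] f.

Let w0 : weighted_fun set0 = 0.
Proof. by rewrite /weighted_fun /weighted set0I integral_set0. Qed.

Let w_ge0 A : 0 <= weighted_fun A.
Proof. by apply: integral_ge0 => x _; rewrite lee_fin. Qed.

Let w_additive : semi_sigma_additive weighted_fun.
Proof.
move=> F mF tF mUF; rewrite /weighted_fun /weighted setIT.
have -> : (fun n => \sum_(0 <= i < n)
    \int[mu]_(x in F i `&` [set: borel T]) (f x)%:E) =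
  (fun n => \sum_(0 <= i < n) \int[mu]_(x in F i) (f x)%:E).
  by apply/funext => n; apply: eq_bigr => i _; rewrite setIT.
rewrite ge0_integral_bigcup//.
- apply: is_cvg_nneseries => n _ _.
  by apply: integral_ge0 => x _; rewrite lee_fin.
- by apply/measurable_EFinP; exact: measurable_funS mf.
- by move=> x _; rewrite lee_fin.
Qed.

HB.instance Definition _ := isMeasure.Build _ _ _ weighted_fun
  w0 w_ge0 w_additive.

(** The weighted set function carries no measure structure by itself; a measure
    equal to it as a function is what the integration lemmas apply to. *)
Lemma exists_weighted : exists nu : {measure set (borel T) -> \bar R},
  (nu : set (borel T) -> \bar R) = weighted mu [set: borel T] f.
Proof. by exists (weighted_fun : {measure set (borel T) -> \bar R}). Qed.

Import HBNNSimple.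

Let integral_weighted_nnsfun (h : {nnsfun borel T >-> R}) :
  \int[weighted_fun]_(x in [set: borel T]) (h x)%:E =
  \int[mu]_(x in [set: borel T]) (h x * f x)%:E.
Proof.
have [nu nuE] := exists_weighted; rewrite /weighted_fun -nuE.
have ind y : measurable_fun [set: borel T]
    (fun x => (y * \1_(h @^-1` [set y]) x)%:E : \bar R).
  by apply/measurable_EFinP; exact: measurable_funM.
transitivity (\int[nu]_(x in [set: borel T])
   (\sum_(y \in range h) (y * \1_(h @^-1` [set y]) x)%:E)).
  by apply: eq_integral => t _; rewrite /= {1}fimfunE -fsumEFin.
rewrite ge0_integral_fsum//; last by move=> y x _; exact: nnfun_muleindic_ge0.
transitivity (\int[mu]_(x in [set: borel T])
   (\sum_(y \in range h) (y * \1_(h @^-1` [set y]) x)%:E * (f x)%:E)).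
  rewrite ge0_integral_fsum//.
  - apply: eq_fsbigr => y; rewrite inE => -[t _ <-].
    have yh : (0 <= h t)%R by [].
    set A := h @^-1` _.
    have mA : measurable A by rewrite /A -[X in measurable X]setTI;
      exact: measurable_funP.
    under eq_integral do rewrite EFinM.
    rewrite ge0_integralZl//; last by apply/measurable_EFinP.
    rewrite integral_indic// setIT.
    under [RHS]eq_integral do rewrite EFinM -muleA.
    rewrite ge0_integralZl//; last 2 first.
    + by apply: emeasurable_funM; apply/measurable_EFinP.
    + by move=> x _; rewrite -EFinM lee_fin mulr_ge0.
    congr (_ * _).
    under eq_integral do rewrite muleC -EFinM.
    rewrite nuE /weighted setIT [LHS]integral_mkcond.
    by apply: eq_integral => x _; rewrite patchE indicE; case: ifP => _;
      rewrite ?mulr1 ?mulr0.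
  - move=> y; apply: emeasurable_funM; first exact: ind.
    exact/measurable_EFinP.
  - by move=> y x _; rewrite mule_ge0 ?lee_fin//; exact: nnfun_muleindic_ge0.
apply: eq_integral => x _.
rewrite -ge0_mule_fsuml; last by move=> y; exact: nnfun_muleindic_ge0.
by rewrite fsumEFin// -(fimfunE h x) EFinM.
Qed.

Lemma ge0_integral_weighted (g : borel T -> \bar R) :
  measurable_fun [set: borel T] g -> (forall x, 0 <= g x) ->
  \int[weighted mu [set: borel T] f]_(x in [set: borel T]) g x =
  \int[mu]_(x in [set: borel T]) (g x * (f x)%:E).
Proof.
move=> mg g0.
pose h := nnsfun_approx measurableT mg.
have hg x : EFin \o h ^~ x @ \oo --> g x by exact: cvg_nnsfun_approx.
have ndh (x : borel T) : nondecreasing_seq (fun n => (h n x)%:E).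
  by move=> m n mn; rewrite lee_fin; exact/lefP/nd_nnsfun_approx.
have [nu nuE] := exists_weighted; rewrite -nuE.
have -> : \int[nu]_(x in [set: borel T]) g x =
    limn (fun n => \int[nu]_(x in [set: borel T]) (h n x)%:E).
  rewrite -monotone_convergence//.
  - by apply: eq_integral => x _; apply/esym/cvg_lim => //; exact: hg.
  - by move=> n; apply/measurable_EFinP.
  - by move=> n x _; rewrite lee_fin.
have -> : \int[mu]_(x in [set: borel T]) (g x * (f x)%:E) =
    limn (fun n => \int[mu]_(x in [set: borel T]) (h n x * f x)%:E).
  rewrite -monotone_convergence//.
  - apply: eq_integral => x _; apply/esym/cvg_lim => //.
    under eq_fun do rewrite EFinM.
    by apply: cvgeZr => //; exact: hg.
  - by move=> n; apply/measurable_EFinP; exact: measurable_funM.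
  - by move=> n x _; rewrite lee_fin mulr_ge0.
  - by move=> x _ m n mn; rewrite lee_fin ler_wpM2r// -lee_fin ndh.
by congr (limn _); apply/funext => n; rewrite nuE integral_weighted_nnsfun.
Qed.

End weighted_measures.

(** * Density of the bounded continuous functions in L1 *)

Section metric_borel.
Context {R : realType} {X : completeMetricType R}.

Lemma near_mdist (p : X) (e : R) : 0 < e -> \forall q \near p, mdist p q < e.
Proof.
move=> e0; have := nbhsx_ballx p e e0; rewrite ballEmdist.
by apply: filterS.
Qed.

Lemma open_mdistP (U : set X) (p : X) : open U -> U p ->
  exists2 e : R, 0 < e & forall q, mdist p q < e -> U q.
Proof.
move=> oU Up; have := open_nbhs_nbhs (conj oU Up).
move=> /nbhs_ballP[e /= e0]; rewrite ballEmdist => H.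
by exists e => // q; exact: H.
Qed.

End metric_borel.

Section continuous_dense.
Context {R : realType} {X : completeMetricType R}.
Variable lam : {finite_measure set (borel X) -> \bar R}.

Let bounded_cont (phi : X -> R) :=
  continuous phi /\ exists M, forall x, `|phi x| <= M.

Definition L1_continuous_approx (f : borel X -> R) := forall e : R, 0 < e ->
  exists2 phi : X -> R, bounded_cont phi &
   (\int[lam]_(x in [set: borel X]) `|f x - phi x|%:E <= e%:E)%E.

Let bounded_contD (a b : R) phi psi : bounded_cont phi -> bounded_cont psi ->
  bounded_cont (fun x => a * phi x + b * psi x).
Proof.
move=> [cphi [M phiM]] [cpsi [N psiN]]; split.
  move=> x; apply: (@cvgD R R^o).
    by apply: cvgM; [exact: cvg_cst|exact: cphi].
  by apply: cvgM; [exact: cvg_cst|exact: cpsi].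
exists (`|a| * M + `|b| * N) => x.
by rewrite (le_trans (ler_normD _ _))// !normrM lerD// ler_wpM2l.
Qed.

Let mEFin_abs (f g : borel X -> R) :
  measurable_fun [set: borel X] f -> measurable_fun [set: borel X] g ->
  measurable_fun [set: borel X] (fun x => `|f x - g x|%:E).
Proof.
move=> mf mg; apply/measurable_EFinP; apply: measurableT_comp => //.
exact: measurable_funB.
Qed.

Let mbc (phi : X -> R) : bounded_cont phi ->
  measurable_fun [set: borel X] (phi : borel X -> R).
Proof. by move=> [cphi _]; exact: continuous_borel_measurableR. Qed.

Lemma L1_continuous_approxD (a b : R) (f g : X -> R) :
  measurable_fun [set: borel X] (f : borel X -> R) ->
  measurable_fun [set: borel X] (g : borel X -> R) ->
  L1_continuous_approx f -> L1_continuous_approx g ->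
  L1_continuous_approx (fun x => a * f x + b * g x).
Proof.
move=> mf mg af ag e e0.
pose c := `|a| + `|b| + 1.
have c0 : 0 < c by rewrite /c addrC ltr_pwDl// addr_ge0.
have ec0 : 0 < e / c by rewrite divr_gt0.
have [phi bphi Hphi] := af _ ec0.
have [psi bpsi Hpsi] := ag _ ec0.
exists (fun x => a * phi x + b * psi x); first exact: bounded_contD.
have mphi := mbc bphi; have mpsi := mbc bpsi.
apply: (@le_trans _ _ (\int[lam]_(x in [set: borel X])
  (`|a|%:E * `|f x - phi x|%:E + `|b|%:E * `|g x - psi x|%:E))%E).
  apply: ge0_le_integral => //.
  - apply: mEFin_abs; first by apply: measurable_funD; apply: measurable_funM.
    by apply: measurable_funD; apply: measurable_funM.
  - apply: emeasurable_funD; apply: emeasurable_funM => //; exact: mEFin_abs.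
  - move=> x _; rewrite -!EFinM -EFinD lee_fin -!normrM.
    by apply: le_trans (ler_normD _ _); rewrite le_eqVlt; apply/orP; left;
      apply/eqP; congr (`|_|); ring.
have mfa := mEFin_abs mf mphi; have mga := mEFin_abs mg mpsi.
rewrite ge0_integralD//; [|exact: emeasurable_funM..].
rewrite ge0_integralZl// ge0_integralZl//.
apply: (@le_trans _ _ (`|a|%:E * (e / c)%:E + `|b|%:E * (e / c)%:E)%E).
  by apply: leeD; apply: lee_wpmul2l.
rewrite -!EFinM -EFinD lee_fin -mulrDl mulrCA ler_piMr ?(ltW e0)//.
by rewrite ler_pdivrMr// mul1r /c lerDl.
Qed.

Lemma L1_continuous_approx_lim (f : X -> R) :
  measurable_fun [set: borel X] (f : borel X -> R) ->
  (forall e : R, 0 < e -> exists g : X -> R,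
    [/\ measurable_fun [set: borel X] (g : borel X -> R),
      L1_continuous_approx g &
      (\int[lam]_(x in [set: borel X]) `|f x - g x|%:E <= e%:E)%E]) ->
  L1_continuous_approx f.
Proof.
move=> mf H e e0.
have e2 : 0 < e / 2 by rewrite divr_gt0.
have [g [mg ag fg]] := H _ e2.
have [phi bphi gphi] := ag _ e2.
exists phi => //.
have mphi := mbc bphi.
rewrite [e]splitr EFinD; apply: le_trans (leeD fg gphi).
rewrite -ge0_integralD//; [|exact: mEFin_abs|exact: mEFin_abs].
apply: ge0_le_integral => //; first exact: mEFin_abs.
  by apply: emeasurable_funD; exact: mEFin_abs.
by move=> x _; rewrite -EFinD lee_fin ler_distD.
Qed.

Let lamfin A : measurable A -> lam A \is a fin_num.
Proof. by move=> mA; rewrite fin_num_measure. Qed.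

(** The regularizations of the indicator of an open set increase to it. *)
Lemma L1_continuous_approx_open (U : set X) : open U ->
  L1_continuous_approx (\1_U : X -> R).
Proof.
move=> oU e e0.
have mU : measurable (U : set (borel X)) by exact: sub_sigma_algebra.
pose g k := yosida (@mdist R X) (fun _ : nat => \1_U : X -> R) k.
have u0 (n : nat) (p : X) : 0 <= (\1_U : X -> R) p by [].
have gle k x : g k x <= \1_U x.
  by apply: (yosida_le (@mdist_ge0 R X) (@mdistxx R X) u0 x (leqnn k)).
have g0 k x : 0 <= g k x by exact: (yosida_ge0 (@mdist_ge0 R X) u0).
have gc k : continuous (g k).
  apply: (yosida_continuous (@mdist_ge0 R X) (@metric_sym R X)) => //.
  - exact: metric_triangle.
  - by move=> p e1; exact: near_mdist.
have mg k : measurable_fun [set: borel X] (g k : borel X -> R).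
  exact: continuous_borel_measurableR.
have ndg x : nondecreasing_seq (g ^~ x).
  exact: (yosida_nondecreasing (@mdist_ge0 R X) u0).
have gcvg x : (g k x)%:E @[k --> \oo] --> ((\1_U : X -> R) x)%:E.
  have [Ux|nUx] := pselect (U x); last first.
    rewrite indicE memNset//; apply: cvg_near_cst; apply: nearW => k.
    by congr EFin; apply/eqP;
      rewrite eq_le g0 andbT (le_trans (gle _ _))// indicE memNset.
  have [d d0 H] := open_mdistP oU Ux.
  have H1 (n : nat) (q : X) : (0 <= n)%N -> mdist x q < d -> 1 <= (\1_U : X -> R) q.
    by move=> _ /H Uq; rewrite indicE mem_set.
  have [k k1] := yosida_sup (@mdist_ge0 R X) u0 d0 H1.
  apply: cvg_near_cst; exists k => // l /= kl; congr EFin.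
  apply/eqP; rewrite eq_le gle indicE mem_set//=.
  by rewrite (le_trans k1)// ndg.
have ig : lam.-integrable [set: borel X] (EFin \o cst 1).
  by apply: finite_measure_integrable_cst.
have m1U : measurable_fun [set: borel X] (\1_U : borel X -> R) by [].
have := @dominated_cvg _ (borel X) R lam [set: borel X] measurableT
  (fun k x => `|(\1_U : X -> R) x - g k x|%:E) (cst 0%E) (EFin \o cst 1).
move=> /(_ (fun k => mEFin_abs m1U (mg k))).
have H x : [set: borel X] x ->
    `|(\1_U : X -> R) x - g k x|%:E @[k --> \oo] --> (0 : \bar R)%E.
  move=> _; have /fine_cvgP[_ /= gx] := gcvg x.
  apply: cvg_EFin; first exact: nearW.
  rewrite -(normr0 R) -(subrr ((\1_U : X -> R) x)).
  by apply: cvg_norm; apply: (@cvgB R R^o) => //; exact: cvg_cst.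
move=> /(_ H (fun _ _ => erefl) ig).
have H1 : forall (n : nat) (x : borel X), [set: borel X] x ->
    (abse (Num.norm ((\1_U : X -> R) x - g n x)%R)%:E <= 1%:E)%E.
  move=> k x _; rewrite /= lee_fin normr_id ger0_norm ?subr_ge0//.
  by rewrite (le_trans (_ : _ <= \1_U x)) ?gerBl// indicE lern1 leq_b1.
move=> /(_ H1); rewrite integral_cst// mul0e => cv.
have e0' : (0 < e%:E)%E by rewrite lte_fin.
have [N _ /(_ N (leqnn N)) HN] := cv _ (open_ereal_lt' e0').
exists (g N); last exact: ltW.
split => //; exists 1 => x; rewrite ger0_norm//.
by rewrite (le_trans (gle _ _))// indicE lern1 leq_b1.
Qed.

Let dynkin_class : set (set (borel X)) :=
  [set A | measurable A /\ L1_continuous_approx (\1_A : borel X -> R)].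

Let mindic (A : set (borel X)) : measurable A ->
  measurable_fun [set: borel X] (\1_A : borel X -> R).
Proof. by []. Qed.

Let lambda_dynkin_class : lambda_system [set: borel X] dynkin_class.
Proof.
split => //.
- by split => //; apply: L1_continuous_approx_open; exact: openT.
- move=> A B BA [mA aA] [mB aB]; split; first exact: measurableD.
  have -> : (\1_(A `\` B) : borel X -> R) = (fun x => 1 * \1_A x + (-1) * \1_B x).
    apply/funext => x; rewrite !indicE mul1r mulN1r in_setD.
    case: (boolP (x \in B)) => xB /=; last by rewrite andbT subr0.
    by rewrite (_ : x \in A) ?subrr ?andbF//; move: xB; rewrite !inE; exact: BA.
  by apply: L1_continuous_approxD.
- move=> F ndF HF; have mF n : measurable (F n) by have [] := HF n.
  have mU : measurable (\bigcup_n F n) by exact: bigcup_measurable.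
  split => //; apply: L1_continuous_approx_lim; first exact: mindic.
  move=> e e0.
  have cv : lam (F n) @[n --> \oo] --> lam (\bigcup_n F n).
    exact: nondecreasing_cvg_mu.
  have [n Hn] : exists n, (lam (\bigcup_n F n) - e%:E < lam (F n))%E.
    have : (lam (\bigcup_n F n) - e%:E < lam (\bigcup_n F n))%E.
      by rewrite lteBlDr// lteDl ?lte_fin// lamfin.
    move=> /open_ereal_gt'/cv[N _ /(_ N (leqnn N)) HN].
    by exists N.
  exists (\1_(F n) : borel X -> R); split; [exact: mindic|by have [] := HF n|].
  have -> : (\int[lam]_(x in [set: borel X])
      `|(\1_(\bigcup_n F n) : borel X -> R) x - \1_(F n) x|%:E)%E =
      lam ((\bigcup_n F n) `\` F n).
    rewrite -[X in _ = lam X]setIT -integral_indic//; last exact: measurableD.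
    apply: eq_integral => x _; congr EFin; rewrite !indicE in_setD.
    have [xF|xF] := boolP (x \in F n).
      rewrite andbF (_ : x \in _) ?subrr ?normr0//.
      by move: xF; rewrite !inE => xF; exists n.
    by rewrite andbT subr0 ger0_norm.
  rewrite measureD//; last by rewrite ltey_eq lamfin.
  rewrite (_ : _ `&` F n = F n); last by apply: setIidr; exact: bigcup_sup.
  rewrite leeBlDr ?lamfin// addeC -leeBlDr//.
  exact: ltW.
Qed.

Let L1_continuous_approx_indic (A : set (borel X)) : measurable A ->
  L1_continuous_approx (\1_A : borel X -> R).
Proof.
move=> mA; suff : dynkin_class A by case.
apply: (lambda_system_subset _ lambda_dynkin_class) mA.
- exact: openI.
- move=> U oU; split; first exact: sub_sigma_algebra.
  exact: L1_continuous_approx_open.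
- by move=> ? _.
Qed.

Import HBSimple.

Let L1_continuous_approx_sfun (f : {sfun borel X >-> R}) :
  L1_continuous_approx (f : borel X -> R).
Proof.
pose s : seq R := finmap.enum_fset (fset_set (range f)).
suff H (r : seq R) : L1_continuous_approx
    (fun x => \sum_(y <- r) y * \1_(f @^-1` [set y]) x : R).
  have -> : (f : borel X -> R) =
      (fun x => \sum_(y <- s) y * \1_(f @^-1` [set y]) x : R).
    by apply/funext => x; rewrite {1}fimfunE fsbig_finite.
  exact: H.
have mf y : measurable (f @^-1` [set y]).
  by rewrite -[X in measurable X]setTI; exact: measurable_funP.
elim: r => [|y r ih].
  under eq_fun do rewrite big_nil.
  move=> e e0; exists (cst 0).
    by split; [exact: cst_continuous|exists 0 => x; rewrite normr0].
  by under eq_integral do rewrite subrr normr0; rewrite integral0 lee_fin ltW.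
have -> : (fun x => \sum_(z <- y :: r) z * \1_(f @^-1` [set z]) x : R) =
   (fun x : borel X => y * \1_(f @^-1` [set y]) x +
     1 * (\sum_(z <- r) z * \1_(f @^-1` [set z]) x)).
  by apply/funext => x; rewrite big_cons mul1r.
apply: L1_continuous_approxD => //.
- by apply: measurable_sum => z; apply: measurable_funM.
- exact: L1_continuous_approx_indic.
Qed.

(** The Borel sets whose indicators can be approximated form a lambda-system
    that contains the open sets, hence all Borel sets; simple functions and
    their L1-limits follow.  Truncation keeps the bound [k] since it does not
    increase the distance to [f]. *)
Lemma bounded_L1_continuous_approx (f : borel X -> R) (k : R) :
  measurable_fun [set: borel X] f -> (forall x, `|f x| <= k) ->
  forall e : R, 0 < e -> exists phi : X -> R,
    [/\ continuous phi, forall x, `|phi x| <= k &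
     (\int[lam]_(x in [set: borel X]) `|f x - phi x|%:E <= e%:E)%E].
Proof.
move=> mf fk e e0.
have k0 : 0 <= k by apply: le_trans (fk point).
have intf : lam.-integrable [set: borel X] (EFin \o f).
  apply: (le_integrable measurableT _ _
    (finite_measure_integrable_cst lam k measurableT)).
  - exact/measurable_EFinP.
  - by move=> x _; rewrite /= lee_fin (ger0_norm k0).
have [h [inth _ h0]] := approximation_sfun_integrable measurableT intf.
have af : L1_continuous_approx f.
  apply: L1_continuous_approx_lim => // d d0.
  have d0' : (0 < d%:E)%E by rewrite lte_fin.
  have [N _ /(_ N (leqnn N)) HN] := h0 _ (open_ereal_lt' d0').
  exists (h N); split => //; exact: ltW.
have [phi [cphi _] fphi] := af _ e0.
exists (fun x => Num.max (- k) (Num.min k (phi x))); split.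
- move=> x; apply: (@continuous_max R X (cst (- k)) (fun x => Num.min k (phi x))).
    exact: cvg_cst.
  by apply: (@continuous_min R X (cst k) phi); [exact: cvg_cst|exact: cphi].
- move=> x; rewrite ler_norml le_max lexx/= ge_max ge_min lexx/=.
  by rewrite (le_trans _ k0)// oppr_le0.
have mphi : measurable_fun [set: borel X] (phi : borel X -> R).
  exact: continuous_borel_measurableR.
apply: le_trans fphi; apply: ge0_le_integral => //.
- apply: mEFin_abs => //; apply: measurable_maxr => //.
  exact: measurable_minr.
- exact: mEFin_abs.
- move=> x _; rewrite lee_fin.
  have := fk x; rewrite ler_norml => /andP[fx1 fx2].
  have := lerNnormlW (lexx `|f x - phi x|); have := ler_norm (f x - phi x).
  move=> fN1 fN2; rewrite ler_norml.
  have [h1|h1] := leP k (phi x).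
    have [h2|h2] := leP (- k) k; last by exfalso; lra.
    by apply/andP; split; lra.
  by have [h2|h2] := leP (- k) (phi x); apply/andP; split; lra.
Qed.

End continuous_dense.

(** * Pointwise inequalities for the entropy density *)

Section entropy_inequalities.
Context {R : realType}.
Implicit Types a rho r c w v : R.

(** Young's inequality for the convex function [rho ln rho], whose conjugate is
    [a |-> exp(a - 1)]. *)
Lemma mul_ln_ge a rho : 0 <= rho -> a * rho - expR (a - 1) <= rho * ln rho.
Proof.
rewrite le_eqVlt => /predU1P[<-|rho0].
  by rewrite mulr0 mul0r sub0r oppr_le0 expR_ge0.
have -> : expR (a - 1) = rho * expR (a - 1 - ln rho).
  by rewrite -[X in X * _](lnK rho0) -expRD; congr expR; ring.
have := ler_wpM2l (ltW rho0) (expR_ge1Dx (a - 1 - ln rho)).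
by rewrite !mulrDr !mulrN mulr1 [a * rho]mulrC; lra.
Qed.

(** Truncation of a density to [[1 / (k + 1), k + 1]]: its logarithm is bounded
    even where the density vanishes. *)
Definition clamp (k : nat) (r : R) : R :=
  Num.max k.+1%:R^-1 (Num.min k.+1%:R r).

Let k1 (k : nat) : 1 <= k.+1%:R :> R. Proof. by rewrite ler1n. Qed.
Let k0 (k : nat) : 0 < k.+1%:R :> R. Proof. by rewrite ltr0n. Qed.
Let kV1 (k : nat) : k.+1%:R^-1 <= 1 :> R. Proof. by rewrite invf_le1 ?k1. Qed.

Lemma clamp_gt0 k r : 0 < clamp k r.
Proof. by rewrite /clamp lt_max invr_gt0 k0. Qed.

Lemma ln_clamp_bounded k r : `|ln (clamp k r)| <= ln k.+1%:R.
Proof.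
rewrite ler_norml; apply/andP; split.
  by rewrite -lnV ?posrE// ler_ln ?posrE ?invr_gt0 ?clamp_gt0// /clamp le_max lexx.
rewrite ler_ln ?posrE ?clamp_gt0// /clamp ge_max ge_min lexx/= andbT.
exact: (le_trans (kV1 k)).
Qed.

(** With [c := clamp k r] this is [(c ln c - c + 1) + (r - c) ln c]: the first
    term is nonnegative by Young's inequality, and [r - c] has the sign of
    [ln c] because the truncation only moves [r] towards [1]. *)
Lemma clamp_entropy_ge0 k r : 0 <= r * ln (clamp k r) - clamp k r + 1.
Proof.
set c := clamp k r; have c0 : 0 < c by exact: clamp_gt0.
have rc : 0 <= (r - c) * ln c.
  have [c1|c1|->] := ltrgtP c 1; last by rewrite ln1 mulr0.
    rewrite nmulr_lge0 ?ln_lt0 ?c0// subr_le0 /c /clamp le_max.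
    move: c1; rewrite /c /clamp gt_max gt_min => /andP[_].
    by rewrite [X in X || _]ltNge k1/= => r1; apply/orP; right;
      rewrite le_min lexx andbT ltW// (lt_le_trans r1).
  rewrite pmulr_lge0 ?ln_gt0// subr_ge0 /c /clamp ge_max ge_min lexx orbT andbT.
  move: c1; rewrite /c /clamp lt_max ltNge kV1/= lt_min => /andP[_ r1].
  by rewrite (le_trans (kV1 k))// ltW.
have := mul_ln_ge 1 (ltW c0); rewrite subrr expR0.
by move: rc; rewrite mulrBl mul1r mulrC [c * ln c]mulrC; lra.
Qed.

End entropy_inequalities.

(** * Legendre duality for the entropy *)

(** The larger function need not be integrable, as is the case for the entropy
    density of a measure of infinite entropy. *)
Lemma integrable_le_integral d (T : measurableType d) (R : realType)
    (mu : {measure set T -> \bar R}) (q f : T -> \bar R) :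
  mu.-integrable [set: T] q -> measurable_fun [set: T] f ->
  (forall x, q x <= f x)%E ->
  (\int[mu]_(x in [set: T]) q x <= \int[mu]_(x in [set: T]) f x)%E.
Proof.
move=> iq mf qf; have mq := measurable_int _ iq.
rewrite [leLHS]integralE [leRHS]integralE; apply: leeB;
  apply: ge0_le_integral => //.
- exact: measurable_funepos.
- exact: measurable_funepos.
- by move=> x _; apply: (@funepos_le _ _ [set: T]) => //; rewrite inE.
- exact: measurable_funeneg.
- exact: measurable_funeneg.
- by move=> x _; apply: (@funeneg_le _ _ [set: T]) => //; rewrite inE.
Qed.

Section entropy_duality.
Context {R : realType} {X : completeMetricType R}.
Variable m : {measure set (borel X) -> \bar R}.
Local Open Scope ereal_scope.

Lemma integral_density (mu : {measure set (borel X) -> \bar R})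
    (rho : borel X -> R) (g : borel X -> \bar R) :
  is_density m mu rho -> measurable_fun [set: borel X] g ->
  \int[mu]_(x in [set: borel X]) g x =
  \int[m]_(x in [set: borel X]) (g x * (rho x)%:E).
Proof.
move=> [mrho rho0 murho] mg.
have [nu nuE] := exists_weighted m mrho rho0.
rewrite (@eq_measure_integral _ _ _ _ nu); last first.
  by move=> A mA _; rewrite murho// nuE.
rewrite [LHS]integralE [RHS]integralE nuE; congr (_ - _).
- rewrite ge0_integral_weighted//; last exact: measurable_funepos.
  by apply: eq_integral => x _; rewrite !funeposE maxe_pMl ?lee_fin// mul0e.
- rewrite ge0_integral_weighted//; last exact: measurable_funeneg.
  by apply: eq_integral => x _; rewrite !funenegE maxe_pMl ?lee_fin// mul0e mulNe.
Qed.

Lemma EntP (mu : set (borel X) -> \bar R) :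
  (exists2 rho, is_density m mu rho &
     Ent m mu = \int[m]_(x in [set: borel X]) (rho x * ln (rho x))%:E) \/
  ((forall rho, ~ is_density m mu rho) /\ Ent m mu = +oo).
Proof.
rewrite /Ent; case: pselect => [ex|nex].
  by left; exists (projT1 (cid ex)) => //; exact: (projT2 (cid ex)).
by right; split => // rho H; apply: nex; exists rho.
Qed.

(** The entropy only depends on the values on measurable sets, since so does the
    set of densities from which it is chosen. *)
Lemma eq_Ent (mu nu : set (borel X) -> \bar R) :
  same_measure mu nu -> Ent m mu = Ent m nu.
Proof.
move=> munu; have E : is_density m mu = is_density m nu.
  apply/funext => rho; apply/propext; split => -[mr r0 H]; split => // A mA.
    by rewrite -munu// H.
  by rewrite munu// H.
by rewrite /Ent E.
Qed.

Variable V : X -> R.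
Hypothesis V0 : forall x, (0 <= V x)%R.
Hypothesis mV : measurable_fun [set: borel X] (V : borel X -> R).
Let w (x : borel X) : R := expR (- V x - 1).
Hypothesis wfin : \int[m]_(x in [set: borel X]) (expR (- V x))%:E < +oo.

Let w0 x : (0 < w x)%R. Proof. exact: expR_gt0. Qed.

Let mw : measurable_fun [set: borel X] w.
Proof.
apply: measurableT_comp => //; apply: measurable_funB => //.
exact: measurable_funN.
Qed.

Let mexpV : measurable_fun [set: borel X] (fun x : borel X => (expR (- V x))%:E).
Proof.
by apply/measurable_EFinP; apply: measurableT_comp => //; exact: measurable_funN.
Qed.

Let intw : m.-integrable [set: borel X] (EFin \o w).
Proof.
apply/integrableP; split; first exact/measurable_EFinP.
apply: le_lt_trans wfin; apply: ge0_le_integral => //.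
- by do 2!apply: measurableT_comp => //.
- move=> x _ /=; rewrite lee_fin ger0_norm ?expR_ge0// ler_expR.
  by rewrite gerBl.
Qed.

Variable mu : probability (borel X) R.
Hypothesis Vfin : \int[mu]_(x in [set: borel X]) (V x)%:E < +oo.

Let N := \int[mu]_(x in [set: borel X]) (V x)%:E.

Let Nfin : N \is a fin_num.
Proof. by rewrite ge0_fin_numE//; apply: integral_ge0 => x _; rewrite lee_fin. Qed.

Section upper_bound_of_duality.
Variable psi : borel X -> R.
Variable k : R.
Hypothesis mpsi : measurable_fun [set: borel X] psi.
Hypothesis psik : forall x, (`|psi x| <= k)%R.

(** One half of the duality, obtained by integrating Young's inequality at
    [a := psi - V].  It is stated without subtraction so that it makes sense
    when the entropy is infinite. *)
Lemma integral_le_Ent :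
  \int[mu]_(x in [set: borel X]) (psi x)%:E <=
  Ent m mu + (N + \int[m]_(x in [set: borel X]) (expR (psi x) * w x)%:E).
Proof.
set Bpsi := \int[m]_(x in _) _.
have B0 : 0 <= Bpsi by apply: integral_ge0 => x _;
  rewrite lee_fin mulr_ge0 ?expR_ge0 ?ltW.
have mexp : measurable_fun [set: borel X] (fun x => (expR (psi x) * w x)%R).
  by apply: measurable_funM => //; exact: measurableT_comp.
have intB : m.-integrable [set: borel X] (fun x => (expR (psi x) * w x)%:E).
  apply: (le_integrable measurableT _ _ (integrableZl measurableT (expR k) intw)).
  - exact/measurable_EFinP.
  - move=> x _ /=; rewrite lee_fin !ger0_norm ?mulr_ge0 ?expR_ge0//.
    rewrite ler_wpM2r ?expR_ge0// ler_expR.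
    by rewrite (le_trans (ler_norm _)).
have Bfin : Bpsi \is a fin_num by exact: integrable_fin_num.
have [[rho drho ->]|[_ ->]] := EntP mu; last first.
  by rewrite addye ?leey// gt_eqF// (lt_le_trans ltNy0)// adde_ge0//
    integral_ge0// => x _; rewrite lee_fin.
have [mrho rho0 murho] := drho.
have NE : N = \int[m]_(x in [set: borel X]) (V x * rho x)%:E.
  rewrite /N (integral_density drho); last exact/measurable_EFinP.
  by apply: eq_integral => x _; rewrite EFinM.
have mVrho : measurable_fun [set: borel X] (fun x : borel X => (V x * rho x)%R).
  exact: measurable_funM.
have intVrho : m.-integrable [set: borel X] (fun x => (V x * rho x)%:E).
  apply/integrableP; split; first exact/measurable_EFinP.
  under eq_integral do rewrite gee0_abs ?lee_fin ?mulr_ge0//.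
  by rewrite -NE -ge0_fin_numE// NE; apply: integral_ge0 => x _;
    rewrite lee_fin mulr_ge0.
have intrho : m.-integrable [set: borel X] (EFin \o rho).
  apply/integrableP; split; first exact/measurable_EFinP.
  under eq_integral do rewrite gee0_abs ?lee_fin//.
  have := murho _ measurableT; rewrite /weighted setIT => <-.
  by rewrite probability_setT ltry.
have mpsirho : measurable_fun [set: borel X] (fun x => (psi x * rho x)%R).
  exact: measurable_funM.
have intpsirho : m.-integrable [set: borel X] (fun x => (psi x * rho x)%:E).
  apply: (le_integrable measurableT _ _ (integrableZl measurableT k intrho)).
  - exact/measurable_EFinP.
  - move=> x _ /=; rewrite lee_fin !normrM ler_wpM2r//.
    by rewrite (le_trans (psik x))// ler_norm.
rewrite (integral_density drho); last exact/measurable_EFinP.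
under eq_integral do rewrite -EFinM.
rewrite NE -leeBlDr; last by rewrite fin_numD Bfin -NE Nfin.
rewrite -integralD// -integralB//; last exact: integrableD.
apply: integrable_le_integral.
- by apply: integrableB => //; exact: integrableD.
- apply/measurable_EFinP; apply: measurable_funM => //.
  by apply: measurableT_comp => //; exact: measurable_ln.
- move=> x /=. rewrite -!EFinD lee_fin.
  have -> : (expR (psi x) * w x = expR (psi x - V x - 1))%R.
    by rewrite /w -expRD; congr expR; ring.
  have := mul_ln_ge (psi x - V x) (rho0 x).
  by rewrite mulrBl opprD addrA.
Qed.

End upper_bound_of_duality.

Variable S : R.
Hypothesis bound_continuous : forall psi : X -> R, continuous psi ->
  (exists M, forall x, (`|psi x| <= M)%R) ->
  \int[mu]_(x in [set: borel X]) (psi x)%:E <=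
  S%:E + (N + \int[m]_(x in [set: borel X]) (expR (psi x) * w x)%:E).

Let exists_gaussian_measure : exists mt : {finite_measure set (borel X) -> \bar R},
  (forall A, mt A = weighted m [set: borel X] w A) /\
  forall g : borel X -> \bar R, measurable_fun [set: borel X] g ->
    (forall x, 0 <= g x) ->
    \int[mt]_(x in [set: borel X]) g x =
    \int[m]_(x in [set: borel X]) (g x * (w x)%:E).
Proof.
have w0' x : (0 <= w x)%R by exact: ltW.
have [nu nuE] := exists_weighted m mw w0'.
have nufin : nu [set: borel X] < +oo.
  rewrite nuE /weighted setIT; have /integrableP[_] := intw.
  by under eq_integral do rewrite /= ger0_norm//.
have [mt mtE] := exists_finite_measure nufin.
exists mt; split => [A|g mg g0]; first by rewrite mtE nuE.
rewrite (@eq_measure_integral _ _ _ _ nu); last first.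
  by move=> A mA _; exact: mtE.
rewrite nuE; exact: ge0_integral_weighted.
Qed.

Let perturbed_bound (a n b c x : \bar R) (k d : R) : (0 <= k)%R ->
  b <= c + k%:E * x -> x <= d%:E ->
  a + (n + b) + d%:E <= a + (n + c) + (k * d + d)%:E.
Proof.
move=> k0 bc xd; rewrite EFinD !addeA leeD2r// -!addeA leeD2l// leeD2l//.
by apply: (le_trans bc); rewrite leeD2l// EFinM lee_wpmul2l// lee_fin.
Qed.

(** A dual bound tested on continuous functions extends to measurable ones: they
    are approximated in [L1(mu + w m)], and [exp] is Lipschitz on bounded
    intervals. *)
Lemma bound_bounded_measurable (psi : borel X -> R) (k : R) :
  measurable_fun [set: borel X] psi -> (forall x, (`|psi x| <= k)%R) ->
  \int[mu]_(x in [set: borel X]) (psi x)%:E <=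
  S%:E + (N + \int[m]_(x in [set: borel X]) (expR (psi x) * w x)%:E).
Proof.
move=> mpsi psik; apply/lee_addgt0Pr => e e0.
have [mt [mtE imt]] := exists_gaussian_measure.
(* the approximation has to be good for both [mu] and [mt] *)
have lamfin : measure_add mu mt [set: borel X] < +oo.
  rewrite measure_addE; apply: lte_add_pinfty.
    exact: (le_lt_trans (probability_le1 mu measurableT) (ltry _)).
  by rewrite ltey_eq (fin_num_measure mt _ measurableT).
have [lam lamE] := exists_finite_measure lamfin.
(* [expR k] is the Lipschitz constant of [exp] on [`]-oo, k]] *)
pose d := (e / (expR k + 1))%R.
have ek1 : (0 < expR k + 1)%R by rewrite addr_gt0// expR_gt0.
have d0 : (0 < d)%R by rewrite divr_gt0.
have [phi [cphi phik lphi]] := bounded_L1_continuous_approx lam mpsi psik d0.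
have mphi : measurable_fun [set: borel X] (phi : borel X -> R).
  exact: continuous_borel_measurableR.
have mdiff : measurable_fun [set: borel X]
    (fun x : borel X => (`|psi x - phi x|)%R%:E).
  apply/measurable_EFinP; apply: measurableT_comp => //.
  exact: measurable_funB.
have diff0 (x : borel X) : 0 <= (`|psi x - phi x|)%R%:E by rewrite lee_fin.
move: lphi; rewrite (@eq_measure_integral _ _ _ _ (measure_add mu mt)); last first.
  by move=> A mA _; exact: lamE.
rewrite ge0_integral_measure_add// imt//.
pose D1 := \int[mu]_(x in [set: borel X]) (`|psi x - phi x|)%R%:E.
pose D2 := \int[m]_(x in [set: borel X]) ((`|psi x - phi x|)%R%:E * (w x)%:E).
rewrite -/D1 -/D2 => D12.
have D10 : 0 <= D1 by apply: integral_ge0 => x _; exact: diff0.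
have D20 : 0 <= D2.
  by apply: integral_ge0 => x _; rewrite mule_ge0 ?lee_fin ?expR_ge0 ?normr_ge0.
have D1d : D1 <= d%:E by apply: le_trans D12; rewrite leeDl.
have D2d : D2 <= d%:E by apply: le_trans D12; rewrite leeDr.
have bint (f : borel X -> R) M : measurable_fun [set: borel X] f ->
    (forall x, (`|f x| <= M)%R) -> mu.-integrable [set: borel X] (EFin \o f).
  move=> mf fM; have M0 : (0 <= M)%R by apply: le_trans (fM point).
  apply: (le_integrable measurableT _ _
    (finite_measure_integrable_cst mu M measurableT)).
  - exact/measurable_EFinP.
  - by move=> x _; rewrite /= lee_fin (ger0_norm M0).
have psiD1 : \int[mu]_(x in [set: borel X]) (psi x)%:E <=
    \int[mu]_(x in [set: borel X]) (phi x)%:E + D1.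
  have idiff : mu.-integrable [set: borel X] (fun x => (`|psi x - phi x|)%R%:E).
    apply: (bint (fun x => `|psi x - phi x|)%R (k + k)%R).
      by apply/measurable_EFinP.
    by move=> x; rewrite normr_id (le_trans (ler_normB _ _))// lerD.
  rewrite -integralD//; last exact: (bint _ k).
  apply: le_integral => //; first exact: (bint _ k).
    by apply: integrableD => //; exact: (bint _ k).
  by move=> x _; rewrite -EFinD lee_fin -lerBlDl ler_norm.
have BD2 : \int[m]_(x in [set: borel X]) (expR (phi x) * w x)%:E <=
    \int[m]_(x in [set: borel X]) (expR (psi x) * w x)%:E + (expR k)%:E * D2.
  rewrite -ge0_integralZl//; last 2 first.
  - by apply: emeasurable_funM => //; exact/measurable_EFinP.
  - by move=> x _; rewrite mule_ge0 ?lee_fin ?expR_ge0 ?normr_ge0.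
  rewrite -ge0_integralD//; last 4 first.
  - by move=> x _; rewrite lee_fin mulr_ge0 ?expR_ge0.
  - apply/measurable_EFinP; apply: measurable_funM => //.
    exact: measurableT_comp.
  - by move=> x _; rewrite !mule_ge0 ?lee_fin ?expR_ge0 ?normr_ge0.
  - do 2 apply: emeasurable_funM => //; exact/measurable_EFinP.
  apply: ge0_le_integral => //.
  - by move=> x _; rewrite lee_fin mulr_ge0 ?expR_ge0.
  - apply/measurable_EFinP; apply: measurable_funM => //.
    exact: measurableT_comp.
  - apply: emeasurable_funD.
      apply/measurable_EFinP; apply: measurable_funM => //.
      exact: measurableT_comp.
    do 2 apply: emeasurable_funM => //; exact/measurable_EFinP.
  - move=> x _; rewrite -!EFinM -EFinD lee_fin mulrA -mulrDl.
    rewrite ler_wpM2r ?expR_ge0//.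
    have [pp|pp] := leP (phi x) (psi x).
      by rewrite ler_wpDr ?mulr_ge0 ?expR_ge0// ler_expR.
    have -> : (expR (psi x) = expR (phi x) * expR (psi x - phi x))%R.
      by rewrite -expRD; congr expR; ring.
    rewrite distrC ger0_norm ?subr_ge0 ?(ltW pp)//.
    have h1 := ler_wpM2l (expR_ge0 (phi x)) (expR_ge1Dx (psi x - phi x)).
    have h2 : (expR (phi x) * (phi x - psi x) <= expR k * (phi x - psi x))%R.
      rewrite ler_wpM2r ?subr_ge0 ?(ltW pp)// ler_expR.
      by rewrite (le_trans (ler_norm _)).
    by move: h1 h2; rewrite !mulrDr !mulrN mulr1; lra.
apply: (le_trans psiD1).
have phiB : exists M, forall x, (`|phi x| <= M)%R by exists k.
apply: (le_trans (leeD (bound_continuous cphi phiB) D1d)).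
have -> : e = (expR k * d + d)%R.
  by rewrite -[X in (_ + X)%R]mul1r -mulrDl /d mulrC divfK// gt_eqF.
by apply: perturbed_bound BD2 D2d; rewrite expR_ge0.
Qed.

(** Testing the bound on [n \1_A] gives [n mu(A) <= const] for all [n] when [A]
    is null for [w m]. *)
Lemma bound_null_dominates (A : set (borel X)) : measurable A ->
  weighted m [set: borel X] w A = 0 -> mu A = 0.
Proof.
move=> mA wA0; apply/eqP; rewrite eq_le measure_ge0 andbT leNgt; apply/negP => muA0.
have [mt [mtE imt]] := exists_gaussian_measure.
have mtA0 : mt A = 0 by rewrite mtE.
have muAfin : mu A \is a fin_num by exact: fin_num_measure.
pose a := fine (mu A); have aE : mu A = a%:E by rewrite fineK.
have a0 : (0 < a)%R by rewrite -lte_fin -aE.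
pose T := fine (mt [set: borel X]).
have TE : mt [set: borel X] = T%:E by rewrite fineK// fin_num_measure.
have bnd (n : nat) : (n%:R * a <= S + (fine N + T))%R.
  have mpsi : measurable_fun [set: borel X] (fun x : borel X =>
    n%:R * \1_A x : R)%R.
    exact: measurable_funM.
  have psin (x : borel X) : (`|n%:R * \1_A x : R| <= n%:R)%R.
    by rewrite ger0_norm ?mulr_ge0// ler_piMr// indicE lern1 leq_b1.
  have := bound_bounded_measurable mpsi psin.
  under eq_integral do rewrite EFinM.
  rewrite ge0_integralZl//; last exact/measurable_EFinP.
  rewrite integral_indic// setIT [X in _ * X]aE -EFinM.
  have -> : \int[m]_(x in [set: borel X]) (expR (n%:R * \1_A x) * w x)%:E =
     \int[mt]_(x in [set: borel X]) (expR (n%:R * \1_A x))%:E.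
    by rewrite imt//; apply/measurable_EFinP; exact: measurableT_comp.
  move=> H; rewrite -lee_fin !EFinD fineK// -TE; apply: (le_trans H).
  rewrite leeD2l// leeD2l//.
  apply: (@le_trans _ _ (\int[mt]_(x in [set: borel X])
      (1 + (expR n%:R)%:E * (\1_A x)%:E))).
    apply: ge0_le_integral => //.
    - by apply/measurable_EFinP; exact: measurableT_comp.
    - apply: emeasurable_funD => //; apply: emeasurable_funM => //.
      exact/measurable_EFinP.
    - move=> x _; rewrite -EFinM -EFinD lee_fin indicE.
      by case: (x \in A); rewrite /= ?mulr1 ?mulr0 ?expR0 ?addr0// lerDr.
  rewrite ge0_integralD//; last first.
    by apply: emeasurable_funM => //; exact/measurable_EFinP.
  rewrite ge0_integralZl ?lee_fin ?expR_ge0//; last exact/measurable_EFinP.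
  by rewrite integral_indic//
    setIT [X in _ * X]mtA0 mule0 adde0 integral_cst// mul1e.
(* the bounds [n a <= const] contradict the archimedean property *)
have := bnd (Num.bound ((S + (fine N + T)) / a)).
have := archi_boundP (_ : (0 <= (S + (fine N + T)) / a)%R).
rewrite divr_ge0 ?(ltW a0)//; last by have := bnd 0%N; rewrite mul0r.
by move=> /(_ isT); rewrite ltr_pdivrMr// => /lt_le_trans/[apply]; rewrite ltxx.
Qed.

Lemma bound_density : exists rho, is_density m mu rho.
Proof.
have [mt [mtE imt]] := exists_gaussian_measure.
have mumt : mu `<< mt.
  apply/null_content_dominatesP => A mA mtA0; apply: bound_null_dominates => //.
  by rewrite -mtE.
have [f [f0 ffin intf muE]] := radon_nikodym_sigma_finite mumt.
have mf : measurable_fun [set: borel X] f by exact: measurable_int intf.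
have fE x : f x = (fine (f x))%:E by rewrite fineK.
exists (fun x => fine (f x) * w x)%R; split.
- apply: measurable_funM => //; apply/measurable_EFinP.
  by rewrite (_ : EFin \o _ = f)//; apply/funext => x /=; rewrite -fE.
- by move=> x; rewrite mulr_ge0 ?fine_ge0 ?expR_ge0.
- move=> A mA; rewrite muE// /weighted setIT [LHS]integral_mkcond imt.
  + rewrite [RHS]integral_mkcond; apply: eq_integral => x _.
    by rewrite !patchE; case: ifP => _; rewrite ?mul0e// EFinM -fE.
  + by apply/(measurable_restrictT _ _).1 => //; exact: measurable_funS mf.
  + by move=> x; apply: erestrict_ge0.
Qed.

(** The other half of the duality.  Let [r] be the density of [mu] with respect
    to [w m].  The optimal test function is [ln r]; its truncations [psi k] are
    admissible, and the integrands [u_ k] of the dual functional, normalized by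
    their value at [psi = 0], are nonnegative and converge to [u], so that
    Fatou's lemma applies. *)
Lemma Ent_le : Ent m mu <= S%:E.
Proof.
have [[rho drho ->]|[nd _]] := EntP mu; last first.
  by have [rho drho] := bound_density; case: (nd rho).
have [mrho rho0 murho] := drho.
pose r (x : borel X) := (rho x / w x)%R.
have rw x : (rho x = r x * w x)%R by rewrite /r divfK// gt_eqF.
have r0 x : (0 <= r x)%R by rewrite divr_ge0// ltW.
pose psi k (x : borel X) := ln (clamp k (r x)).
pose u_ k (x : borel X) := (psi k x * rho x - expR (psi k x) * w x + w x)%R.
pose u (x : borel X) := (rho x * ln (rho x) + (V x * rho x + w x))%R.
have mwV : measurable_fun [set: borel X] (fun x : borel X => (w x)^-1)%R.
  have -> : (fun x : borel X => (w x)^-1)%R = (fun x : borel X => expR (V x + 1))%R.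
    by apply/funext => x; rewrite /w -expRN opprB opprK addrC.
  by apply: measurableT_comp => //; exact: measurable_funD.
have mr : measurable_fun [set: borel X] r by exact: measurable_funM.
have mpsi k : measurable_fun [set: borel X] (psi k).
  apply: measurableT_comp; first exact: measurable_ln.
  apply: measurable_maxr => //; exact: measurable_minr.
have mpsirho k : measurable_fun [set: borel X] (fun x => psi k x * rho x)%R.
  exact: measurable_funM.
have mexp k : measurable_fun [set: borel X] (fun x => expR (psi k x) * w x)%R.
  by apply: measurable_funM => //; exact: measurableT_comp.
have mu_ k : measurable_fun [set: borel X] (u_ k).
  by apply: measurable_funD => //; exact: measurable_funB.
have u_0 k x : (0 <= u_ k x)%R.
  rewrite /u_ /psi lnK ?posrE ?clamp_gt0// rw.
  have -> : (ln (clamp k (r x)) * (r x * w x) - clamp k (r x) * w x + w x =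
    (r x * ln (clamp k (r x)) - clamp k (r x) + 1) * w x)%R by ring.
  by rewrite mulr_ge0 ?expR_ge0// clamp_entropy_ge0.
have NE : N = \int[m]_(x in [set: borel X]) (V x * rho x)%:E.
  rewrite /N (integral_density drho); last exact/measurable_EFinP.
  by apply: eq_integral => x _; rewrite EFinM.
have intVrho : m.-integrable [set: borel X] (fun x => (V x * rho x)%:E).
  apply/integrableP; split; first by apply/measurable_EFinP; exact: measurable_funM.
  under eq_integral do rewrite gee0_abs ?lee_fin ?mulr_ge0//.
  by rewrite -NE.
have intrho : m.-integrable [set: borel X] (EFin \o rho).
  apply/integrableP; split; first exact/measurable_EFinP.
  under eq_integral do rewrite gee0_abs ?lee_fin//.
  have := murho _ measurableT; rewrite /weighted setIT => <-.
  by rewrite probability_setT ltry.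
pose W := \int[m]_(x in [set: borel X]) (w x)%:E.
have Wfin : W \is a fin_num by exact: integrable_fin_num.
have intu_ k : \int[m]_(x in [set: borel X]) (u_ k x)%:E <= S%:E + (N + W).
  have ipr : m.-integrable [set: borel X] (fun x => (psi k x * rho x)%:E).
    apply: (le_integrable measurableT _ _
      (integrableZl measurableT (ln k.+1%:R) intrho)); first exact/measurable_EFinP.
    move=> x _ /=; rewrite lee_fin !normrM ler_wpM2r//.
    by rewrite (le_trans (ln_clamp_bounded k (r x)))// ler_norm.
  have iew : m.-integrable [set: borel X] (fun x => (expR (psi k x) * w x)%:E).
    apply: (le_integrable measurableT _ _
      (integrableZl measurableT (expR (ln k.+1%:R)) intw));
        first exact/measurable_EFinP.
    move=> x _ /=; rewrite lee_fin !ger0_norm ?mulr_ge0 ?expR_ge0//.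
    rewrite ler_wpM2r ?expR_ge0// ler_expR.
    by rewrite (le_trans (ler_norm _))// ln_clamp_bounded.
  have B := bound_bounded_measurable (mpsi k) (fun x => ln_clamp_bounded k (r x)).
  move: B; rewrite (integral_density drho); last exact/measurable_EFinP.
  under eq_integral do rewrite -EFinM.
  move=> B.
  under eq_integral do rewrite /u_ EFinD EFinB.
  rewrite integralD//; last exact: integrableB.
  rewrite integralB// -/W.
  have := integrable_fin_num measurableT ipr.
  have := integrable_fin_num measurableT iew.
  move: B; move: (\int[m]_(x in _) _) (\int[m]_(x in _) _) W Wfin N Nfin.
  by move=> [a| |] [b| |]//= [c| |]//= _ [d| |]//= _ + _ _;
    rewrite -!EFinD !lee_fin; lra.
have limu x : (u_ k x)%:E @[k --> \oo] --> (u x)%:E.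
  apply: cvg_EFin; first exact: nearW.
  have [rx0|rx0] := eqVneq (r x) 0%R.
    have rhox : (rho x = 0)%R by rewrite rw rx0 mul0r.
    have ux : (u x = - 0 * w x + w x)%R
      by rewrite /u rhox !(mul0r, mulr0) oppr0 mul0r !add0r.
    have u_x k : (u_ k x = - harmonic k * w x + w x)%R.
      rewrite /u_ /psi rhox mulr0 sub0r lnK ?posrE ?clamp_gt0// rx0 /clamp/=.
      rewrite [Num.min _ _]min_r ?ler0n// max_l ?invr_ge0 ?ler0n//.
      by rewrite mulNr.
    rewrite ux /comp/=; under eq_fun do rewrite u_x.
    apply: (@cvgD R R^o); last exact: cvg_cst.
    apply: cvgM; last exact: cvg_cst.
    by apply: (@cvgN R R^o); exact: cvg_harmonic.
  have rx : (0 < r x)%R by rewrite lt_neqAle eq_sym rx0 r0.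
  apply: cvg_near_cst; near=> k; rewrite /= /u_ /u /psi lnK ?posrE ?clamp_gt0//.
  have -> : clamp k (r x) = r x.
    rewrite /clamp min_r; last first.
      rewrite ltW// (lt_le_trans (archi_boundP (r0 x)))// ler_nat.
      by apply: leqW; near: k; exact: nbhs_infty_ge.
    apply: max_r; rewrite -[leRHS]invrK lef_pV2 ?posrE ?invr_gt0//.
    have rV0 : (0 <= (r x)^-1)%R by rewrite invr_ge0.
    rewrite ltW// (lt_le_trans (archi_boundP rV0))// ler_nat.
    by apply: leqW; near: k; exact: nbhs_infty_ge.
  rewrite [in X in (_ - X)%R]/r divfK ?gt_eqF// /r ln_div ?posrE ?w0//; last first.
    by rewrite rw mulr_gt0.
  by rewrite /w expRK; ring.
have mu_u : measurable_fun [set: borel X] u.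
  apply: measurable_funD; last first.
    by apply: measurable_funD => //; exact: measurable_funM.
  apply: measurable_funM => //.
  by apply: measurableT_comp => //; exact: measurable_ln.
have fat : \int[m]_(x in [set: borel X]) (u x)%:E <= S%:E + (N + W).
  have -> : \int[m]_(x in [set: borel X]) (u x)%:E =
     \int[m]_(x in [set: borel X]) limn_einf (fun k => (u_ k x)%:E).
    by apply: eq_integral => x _; rewrite (cvg_limn_einf_sup (limu x)).1.
  have F0 k (x : borel X) : [set: borel X] x -> 0 <= (u_ k x)%:E by rewrite lee_fin.
  apply: (le_trans (fatou m measurableT (fun k =>
    (measurable_EFinP _ _).2 (mu_ k)) F0)).
  rewrite limn_einf_lim; apply: lime_le; first exact: is_cvg_einfs.
  apply: nearW => k; apply: le_trans (intu_ k).
  by apply: ereal_inf_lbound; exists k => //=.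
(* [u] is the Young gap at [a = - V] *)
have u0 x : (0 <= u x)%R.
  have := mul_ln_ge (- V x) (rho0 x); rewrite /u /w mulNr.
  by move: (expR _) (rho x * ln _)%R (V x * _)%R => a b c; lra.
have NWfin : N + W \is a fin_num by rewrite fin_numD Nfin.
have intu : m.-integrable [set: borel X] (EFin \o u).
  apply/integrableP; split; first exact/measurable_EFinP.
  under eq_integral do rewrite gee0_abs ?lee_fin//.
  apply: (le_lt_trans fat).
  by rewrite ltey_eq fin_numD NWfin.
have intVw : m.-integrable [set: borel X] (fun x => (V x * rho x)%:E + (w x)%:E).
  exact: integrableD.
have -> : \int[m]_(x in [set: borel X]) (rho x * ln (rho x))%:E =
   \int[m]_(x in [set: borel X]) ((u x)%:E - ((V x * rho x)%:E + (w x)%:E)).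
  apply: eq_integral => x _; rewrite -!EFinD; congr EFin; rewrite /u.
  by ring.
rewrite integralB// integralD// -NE -/W leeBlDr//.
Unshelve. all: by end_near. Qed.

End entropy_duality.

(** * Distances on X * X *)

Section distances.
Context {R : realType} {X : completeMetricType R}.

Lemma mdist_is_distance : is_distance (@mdist R X).
Proof.
split; [exact: mdist_ge0| |exact: metric_sym|].
  by move=> x y; split => [/mdist_positivity|->]; [|exact: mdistxx].
by move=> x y z; exact: metric_triangle.
Qed.

Lemma metrizes_near (dist : X -> X -> R) x (e : R) : metrizes dist -> 0 < e ->
  \forall y \near x, dist x y < e.
Proof. by move=> dX e0; rewrite /prop_near1 dX; exists e. Qed.

Lemma distance_continuous (dist : X -> X -> R) : is_distance dist ->
  (forall x (e : R), 0 < e -> \forall y \near x, dist x y < e) ->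
  continuous (fun p : X * X => dist p.1 p.2).
Proof.
move=> [_ _ dsym dtri] dnear [x y]; apply/cvgrPdist_lt => e e0 /=.
have e2 : 0 < e / 2 by rewrite divr_gt0.
exists ([set z | dist x z < e / 2], [set z | dist y z < e / 2]).
  by split; exact: dnear.
move=> [x' y'] [/= xx' yy'].
rewrite [e]splitr; apply: le_lt_trans (ltrD xx' yy').
have := dtri x x' y; have := dtri x' y' y.
have := dtri x' x y'; have := dtri x y y'.
by rewrite ler_norml (dsym y' y) (dsym x' x) => *; apply/andP; split; lra.
Qed.

Lemma mdist_continuous : continuous (fun p : X * X => mdist p.1 p.2).
Proof.
by apply: distance_continuous; [exact: mdist_is_distance|exact: near_mdist].
Qed.

Definition prod_mdist (p q : X * X) : R := mdist p.1 q.1 + mdist p.2 q.2.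

Lemma prod_mdist_ge0 p q : 0 <= prod_mdist p q.
Proof. by rewrite /prod_mdist addr_ge0 ?mdist_ge0. Qed.

Lemma prod_mdistxx p : prod_mdist p p = 0.
Proof. by rewrite /prod_mdist !mdistxx addr0. Qed.

Lemma prod_mdist_sym p q : prod_mdist p q = prod_mdist q p.
Proof. by rewrite /prod_mdist metric_sym [X in _ + X]metric_sym. Qed.

Lemma prod_mdist_triangle p q r : prod_mdist p r <= prod_mdist p q + prod_mdist q r.
Proof. by rewrite /prod_mdist addrACA lerD// metric_triangle. Qed.

Lemma near_prod_mdist p (e : R) : 0 < e -> \forall q \near p, prod_mdist p q < e.
Proof.
move=> e0; have e2 : 0 < e / 2 by rewrite divr_gt0.
exists ([set z | mdist p.1 z < e / 2], [set z | mdist p.2 z < e / 2]).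
  by split; exact: near_mdist.
by move=> q [/= h1 h2]; rewrite [e]splitr ltrD.
Qed.

Lemma nbhs_prod_mdist (p : X * X) (U : set (X * X)) : nbhs p U ->
  exists2 e : R, 0 < e & forall q, prod_mdist p q < e -> U q.
Proof.
move=> /nbhs_ballP[e /= e0 H]; exists e => // q pq; apply: H.
split; rewrite ballEmdist/=; apply: le_lt_trans pq.
  by rewrite /prod_mdist lerDl mdist_ge0.
by rewrite /prod_mdist lerDr mdist_ge0.
Qed.

Variable d_ : nat -> X -> X -> R.
Hypothesis d_cvg : locally_uniformly_cvg d_ (@mdist R X).

Lemma locally_uniformly_cvg_near (p : X * X) (e : R) : 0 < e ->
  exists2 r : R, 0 < r & exists N, forall n q, (N <= n)%N ->
    prod_mdist p q < r -> `|mdist q.1 q.2 - d_ n q.1 q.2| < e.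
Proof.
move=> e0; have [U pU dU] := d_cvg p.
have [r r0 rU] := nbhs_prod_mdist pU; exists r => //.
pose E := [set h : X * X -> R | forall q, U q -> `|mdist q.1 q.2 - h q| < e].
have : nbhs ((fun q : X * X => mdist q.1 q.2 : R) : {uniform` U -> R}) E.
  apply/uniform_nbhs; exists [set xy | ball xy.1 e xy.2]; split.
    exact: (entourage_ball _ (PosNum e0)).
  by move=> h /= H q Uq; have := H q Uq; rewrite /ball/=.
by move=> /dU[N _ HN]; exists N => n q Nn pq; apply: (HN n Nn); exact: rU.
Qed.

Lemma cvg_distance p : d_ n p.1 p.2 @[n --> \oo] --> mdist p.1 p.2.
Proof.
apply/cvgrPdist_lt => e e0; have [r r0 [N H]] := locally_uniformly_cvg_near p e0.
by exists N => // n Nn; apply: H => //; rewrite prod_mdistxx.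
Qed.

(** The Gamma-lower limit inequality for the squared distances, as required by
    [weakly_cvg_fatou]. *)
Lemma sqr_distance_lower_bound (phi : nat -> nat) p (e : R) :
  (forall n x y, 0 <= d_ n x y) -> (forall n, (n <= phi n)%N) -> 0 < e ->
  exists2 r, 0 < r & exists N, forall n q, (N <= n)%N -> prod_mdist p q < r ->
    mdist p.1 p.2 ^+ 2 - e <= d_ (phi n) q.1 q.2 ^+ 2.
Proof.
move=> d0 phin e0; set y := mdist p.1 p.2.
have y0 : 0 <= y by exact: mdist_ge0.
(* a point at distance [>= y - 2 eta] has squared distance [>= y^2 - 4 eta y] *)
pose eta := e / (4 * y + 1).
have y41 : 0 < 4 * y + 1 by rewrite ltr_wpDl// mulr_ge0.
have eta0 : 0 < eta by rewrite divr_gt0.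
have [r r0 [N H]] := locally_uniformly_cvg_near p eta0.
exists (Num.min r eta); first by rewrite lt_min r0.
exists N => n q Nn; rewrite lt_min => /andP[pqr pqeta].
have := H (phi n) q (leq_trans Nn (phin n)) pqr.
have yq : y <= mdist q.1 q.2 + eta.
  have := metric_triangle p.1 q.1 p.2; have := metric_triangle q.1 q.2 p.2.
  by move: pqeta; rewrite /prod_mdist (metric_sym p.2); rewrite -/y; lra.
rewrite ltr_norml => /andP[_ dz].
have z0 := d0 (phi n) q.1 q.2.
set z := d_ _ _ _ in dz z0 *.
have yz : y - 2 * eta <= z by lra.
have ye : 4 * eta * y <= e.
  have : eta * (4 * y + 1) = e by rewrite divfK// gt_eqF.
  by rewrite mulrDr mulr1 (_ : 4 * eta * y = eta * (4 * y)); [lra|ring].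
have [h|h] := leP (2 * eta) y; nra.
Qed.

End distances.

(** * Push-forwards and couplings *)

Section push.
Import HBNNSimple.
Context {R : realType}.
Local Open Scope ereal_scope.

(** Integration against a set function only looks at level sets of simple
    functions, so this holds for set functions that are not measures. *)
Lemma same_measure_integral (T : ptopologicalType)
    (mu nu : set (borel T) -> \bar R) (D : set (borel T)) (f : borel T -> \bar R) :
  same_measure mu nu -> \int[mu]_(x in D) f x = \int[nu]_(x in D) f x.
Proof.
move=> munu.
have E (h : {nnsfun borel T >-> R}) : sintegral mu h = sintegral nu h.
  apply: eq_fsbigr => r _; rewrite munu//.
rewrite /integral; congr (ereal_sup _ - ereal_sup _);
  by apply/seteqP; split => _ [h hf <-]; exists h.
Qed.

Lemma exists_push (S T : ptopologicalType)
    (pi : {measure set (borel S) -> \bar R}) (f : S -> T) :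
  measurable_fun [set: borel S] (f : borel S -> borel T) ->
  exists nu : {measure set (borel T) -> \bar R},
    (nu : set (borel T) -> \bar R) = push pi f.
Proof.
move=> mf.
pose nu : {measure set (borel T) -> \bar R} :=
  measure_function_pushforward__canonical__measure_function_Measure pi mf.
by exists nu.
Qed.

Lemma exists_push_probability (S T : ptopologicalType)
    (pi : probability (borel S) R) (f : S -> T) :
  measurable_fun [set: borel S] (f : borel S -> borel T) ->
  exists P : probability (borel T) R, forall A, P A = push pi f A.
Proof.
move=> mf; have [nu nuE] := exists_push pi mf.
have nu1 : nu [set: borel T] = 1.
  by rewrite nuE; exact: (probability_setT pi).
by have [P PE] := exists_probability nu1; exists P => A; rewrite PE nuE.
Qed.

Lemma integral_push (S T : ptopologicalType)
    (pi : {measure set (borel S) -> \bar R}) (f : S -> T) (g : borel T -> \bar R) :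
  measurable_fun [set: borel S] (f : borel S -> borel T) ->
  measurable_fun [set: borel T] g ->
  \int[push pi f]_(x in [set: borel T]) g x =
  \int[pi]_(x in [set: borel S]) g (f x).
Proof.
move=> mf mg; have [nu nuE] := exists_push pi mf; rewrite -nuE.
rewrite [LHS]integralE [RHS]integralE nuE; congr (_ - _).
- rewrite ge0_integral_pushforward//; last exact: measurable_funepos.
  by rewrite preimage_setT; apply: eq_integral => x _; rewrite /= !funeposE.
- rewrite ge0_integral_pushforward//; last exact: measurable_funeneg.
  by rewrite preimage_setT; apply: eq_integral => x _; rewrite /= !funenegE.
Qed.

End push.

Section couplings.
Context {R : realType} {X : completeMetricType R}.
Local Open Scope ereal_scope.
Implicit Types mu nu : probability (borel X) R.
Implicit Types pi : probability (borel (X * X)%type) R.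

Let fst_continuous : continuous (fst : X * X -> X).
Proof. by move=> p; exact: cvg_fst. Qed.

Let snd_continuous : continuous (snd : X * X -> X).
Proof. by move=> p; exact: cvg_snd. Qed.

Lemma coupling_integral_fst mu nu pi (g : borel X -> \bar R) :
  coupling mu nu pi -> measurable_fun [set: borel X] g ->
  \int[pi]_(p in [set: borel (X * X)%type]) g p.1 =
  \int[mu]_(x in [set: borel X]) g x.
Proof.
move=> [pimu _] mg; rewrite -(same_measure_integral _ _ pimu).
by rewrite integral_push//; exact: continuous_borel_measurable.
Qed.

Lemma coupling_integral_snd mu nu pi (g : borel X -> \bar R) :
  coupling mu nu pi -> measurable_fun [set: borel X] g ->
  \int[pi]_(p in [set: borel (X * X)%type]) g p.2 =
  \int[nu]_(x in [set: borel X]) g x.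
Proof.
move=> [_ pinu] mg; rewrite -(same_measure_integral _ _ pinu).
by rewrite integral_push//; exact: continuous_borel_measurable.
Qed.

Definition sqdist (x0 x : X) : R := (mdist x x0 ^+ 2)%R.

Lemma sqdist_ge0 x0 x : (0 <= sqdist x0 x)%R.
Proof. exact: sqr_ge0. Qed.

Lemma sqdist_continuous x0 : continuous (sqdist x0).
Proof.
move=> x; rewrite /sqdist.
have c : continuous (fun x : X => mdist x x0 : R).
  move=> z; apply: (@continuous_comp _ _ _ (fun x : X => (x, x0)) (fun p =>
    mdist p.1 p.2)).
    by apply: cvg_pair => //=; exact: cvg_cst.
  exact: mdist_continuous.
by apply: (@cvgM R _ _ _ (fun x : X => mdist x x0 : R)); exact: c.
Qed.

Lemma measurable_sqdist x0 :
  measurable_fun [set: borel X] (fun x : borel X => (sqdist x0 x)%:E).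
Proof.
apply/measurable_EFinP; apply: continuous_borel_measurableR.
exact: sqdist_continuous.
Qed.

Lemma sqdist_triangle x0 (y x : X) :
  (sqdist x0 x <= 2 * sqdist y x + 2 * sqdist x0 y)%R.
Proof.
rewrite /sqdist.
have := metric_triangle x y x0; have := @mdist_ge0 R X x x0.
have := @mdist_ge0 R X x y; have := @mdist_ge0 R X y x0.
set a := mdist _ _; set b := mdist _ _; set c := mdist _ _ => a0 b0 c0 h.
have : (c ^+ 2 <= (b + a) ^+ 2)%R by rewrite lerXn2r ?nnegrE ?addr_ge0.
have : (0 <= (b - a) ^+ 2)%R by exact: sqr_ge0.
by rewrite sqrrB sqrrD; lra.
Qed.

Lemma P2_base mu x0 : P2 (@mdist R X) mu ->
  \int[mu]_(x in [set: borel X]) (sqdist x0 x)%:E < +oo.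
Proof.
move=> [y muy]; have ms := measurable_sqdist.
apply: (@le_lt_trans _ _ (\int[mu]_(x in [set: borel X])
    (2%:E * (sqdist y x)%:E + (2 * sqdist x0 y)%:E))).
  apply: ge0_le_integral => //.
  - by move=> x _; rewrite lee_fin sqdist_ge0.
  - by apply: emeasurable_funD => //; exact: emeasurable_funM.
  - by move=> x _; rewrite -EFinM -EFinD lee_fin sqdist_triangle.
have s0 (x : borel X) : 0 <= (sqdist y x)%:E by rewrite lee_fin sqdist_ge0.
have c0 : 0 <= (2 * sqdist x0 y)%:E by rewrite lee_fin mulr_ge0// sqdist_ge0.
have m2 := emeasurable_funM (measurable_cst 2%:E) (ms y).
have s2 (x : borel X) : [set: borel X] x -> 0 <= 2%:E * (sqdist y x)%:E
  by rewrite mule_ge0.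
rewrite (ge0_integralD mu measurableT s2 m2)// ge0_integralZl//.
rewrite integral_cst// [X in _ + _ * X]probability_setT mule1.
by apply: lte_add_pinfty; [exact: lte_mul_pinfty|exact: ltry].
Qed.

Lemma W2sq_opt (dist : X -> X -> R) mu nu pi :
  OptPlans dist mu nu pi -> W2sq dist mu nu = cost dist pi.
Proof.
move=> [cpi opt]; apply/eqP; rewrite eq_le; apply/andP; split.
  by apply: ereal_inf_lbound; exists pi.
by apply: le_ereal_inf_tmp => _ [pi' cpi' <-]; exact: opt.
Qed.

End couplings.

(** * Lower semicontinuity of the entropy along plans *)

Section limits.
Context {R : realType} {X : completeMetricType R}.
Local Open Scope ereal_scope.
Local Notation XX := (X * X)%type.
Implicit Types pi : probability (borel XX) R.

Lemma continuous_prod_mdist (u : XX -> R) p (e : R) : continuous u -> (0 < e)%R ->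
  exists2 d : R, (0 < d)%R & forall q, (prod_mdist p q < d -> `|u p - u q| < e)%R.
Proof.
move=> cu e0; apply: (@nbhs_prod_mdist _ _ p [set q | (`|u p - u q| < e)%R]).
by have /cvgrPdist_lt/(_ _ e0) := cu p.
Qed.

Variables (x0 : X) (mu nu : probability (borel X) R).
Hypothesis mufin : \int[mu]_(x in [set: borel X]) (sqdist x0 x)%:E < +oo.
Hypothesis nufin : \int[nu]_(x in [set: borel X]) (sqdist x0 x)%:E < +oo.

Let bound (C : R) (p : XX) : R := (C * sqdist x0 p.1 + C * sqdist x0 p.2)%R.

Let bound_continuous C : continuous (bound C : XX -> R).
Proof.
have c i : continuous (fun p : XX => sqdist x0 (if i then p.1 else p.2)).
  move=> p; apply: continuous_comp; last exact: sqdist_continuous.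
  by case: i; [exact: cvg_fst|exact: cvg_snd].
move=> p; apply: (@cvgD R R^o); apply: cvgM; do ?exact: cvg_cst.
  exact: (c true).
exact: (c false).
Qed.

(** The integral of a sum of functions of the two coordinates depends on the
    marginals only, hence is the same constant for all couplings. *)
Lemma coupling_second_moment (C : R) : (0 <= C)%R -> exists S : R,
  forall pi, coupling mu nu pi ->
  \int[pi]_(p in [set: borel XX]) (C * sqdist x0 p.1 + C * sqdist x0 p.2)%:E = S%:E.
Proof.
move=> C0.
have sq0 (P : probability (borel X) R) :
  0 <= \int[P]_(x in [set: borel X]) (sqdist x0 x)%:E.
  by apply: integral_ge0 => x _; rewrite lee_fin sqdist_ge0.
exists (C * fine (\int[mu]_(x in [set: borel X]) (sqdist x0 x)%:E) +
  C * fine (\int[nu]_(x in [set: borel X]) (sqdist x0 x)%:E))%R => pi cpi.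
rewrite EFinD !EFinM !fineK ?ge0_fin_numE//.
have mC : measurable_fun [set: borel X] (fun x : borel X =>
  C%:E * (sqdist x0 x)%:E).
  by apply: emeasurable_funM => //; exact: measurable_sqdist.
have C0' (x : X) : 0 <= C%:E * (sqdist x0 x)%:E.
  by rewrite -EFinM lee_fin mulr_ge0// sqdist_ge0.
have m1 : measurable_fun [set: borel XX] (fun p : borel XX =>
  C%:E * (sqdist x0 p.1)%:E).
  apply: emeasurable_funM => //; apply/measurable_EFinP.
  apply: continuous_borel_measurableR => p; apply: continuous_comp;
    first exact: cvg_fst.
  exact: sqdist_continuous.
have m2 : measurable_fun [set: borel XX] (fun p : borel XX =>
  C%:E * (sqdist x0 p.2)%:E).
  apply: emeasurable_funM => //; apply/measurable_EFinP.
  apply: continuous_borel_measurableR => p; apply: continuous_comp;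
    first exact: cvg_snd.
  exact: sqdist_continuous.
under eq_integral do rewrite EFinD !EFinM.
rewrite (ge0_integralD pi measurableT
  (fun p _ => C0' p.1) m1 (fun p _ => C0' p.2) m2).
rewrite (coupling_integral_fst cpi mC) (coupling_integral_snd cpi mC).
have ms := measurable_sqdist x0.
by rewrite !ge0_integralZl// => x _; rewrite lee_fin sqdist_ge0.
Qed.

Lemma coupling_integral_fin (C : R) (h : XX -> R) pi : (0 <= C)%R ->
  coupling mu nu pi -> measurable_fun [set: borel XX] (h : borel XX -> R) ->
  (forall p, 0 <= h p)%R ->
  (forall p, h p <= C * sqdist x0 p.1 + C * sqdist x0 p.2)%R ->
  \int[pi]_(p in [set: borel XX]) (h p)%:E \is a fin_num.
Proof.
move=> C0 cpi mh h0 hC; have [S /(_ _ cpi) SE] := coupling_second_moment C0.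
rewrite ge0_fin_numE; last by apply: integral_ge0 => p _; rewrite lee_fin.
apply: le_lt_trans (ltry S); rewrite -SE.
apply: ge0_le_integral => //.
- by move=> p _; rewrite lee_fin.
- exact/measurable_EFinP.
- apply/measurable_EFinP.
  have mb : measurable_fun [set: borel XX] (bound C : borel XX -> R).
    apply: continuous_borel_measurableR; exact: bound_continuous.
  exact: mb.
- by move=> p _; rewrite lee_fin.
Qed.

Variables (pi_ : nat -> probability (borel XX) R) (pi : probability (borel XX) R).
Hypothesis pi_cvg : weakly_cvg pi_ pi.
Hypothesis cpi_ : forall n, coupling mu nu (pi_ n).
Hypothesis cpi : coupling mu nu pi.

Lemma weakly_cvg_fatou_plans (u_ : nat -> XX -> R) (u : XX -> R) (c : R) :
  (forall n p, 0 <= u_ n p)%R -> (forall p, 0 <= u p)%R ->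
  (forall n, continuous (u_ n)) -> continuous u ->
  (forall p (e : R), 0 < e -> exists2 d, 0 < d & exists N, forall n q,
     (N <= n)%N -> prod_mdist p q < d -> u p - e <= u_ n q)%R ->
  c%:E < \int[pi]_(x in [set: borel XX]) (u x)%:E ->
  \forall n \near \oo, c%:E < \int[pi_ n]_(x in [set: borel XX]) (u_ n x)%:E.
Proof.
move=> u_0 u0 cu_ cu H; apply: (weakly_cvg_fatou (D := prod_mdist)) => //.
- exact: prod_mdist_ge0.
- exact: prod_mdistxx.
- exact: prod_mdist_sym.
- exact: prod_mdist_triangle.
- exact: near_prod_mdist.
- by move=> n; exact: continuous_borel_measurableR.
- exact: continuous_borel_measurableR.
Qed.

(** Upper semicontinuity along couplings with fixed marginals: [h] is dominated
    by a function [bound C] whose integral does not depend on the coupling, and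
    [weakly_cvg_fatou] applies to the difference. *)
Lemma coupling_integral_upper (C : R) (h : XX -> R) (e : R) : (0 <= C)%R ->
  continuous h -> (forall p, 0 <= h p)%R ->
  (forall p, h p <= C * sqdist x0 p.1 + C * sqdist x0 p.2)%R -> (0 < e)%R ->
  \forall n \near \oo, \int[pi_ n]_(p in [set: borel XX]) (h p)%:E <=
     \int[pi]_(p in [set: borel XX]) (h p)%:E + e%:E.
Proof.
move=> C0 ch h0 hC e0; have [S SE] := coupling_second_moment C0.
have mh : measurable_fun [set: borel XX] (h : borel XX -> R).
  exact: continuous_borel_measurableR.
pose u (p : XX) := (bound C p - h p)%R.
have cu : continuous u.
  by move=> p; apply: (@cvgB R R^o); [exact: bound_continuous|exact: ch].
have u0 p : (0 <= u p)%R by rewrite subr_ge0.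
have mu_ : measurable_fun [set: borel XX] (u : borel XX -> R).
  exact: continuous_borel_measurableR.
have sumE (P : probability (borel XX) R) : coupling mu nu P ->
  \int[P]_(p in [set: borel XX]) (u p)%:E +
    \int[P]_(p in [set: borel XX]) (h p)%:E = S%:E.
  move=> cP; rewrite -(SE P cP) -ge0_integralD//.
  - by apply: eq_integral => p _; rewrite -EFinD subrK.
  - by move=> p _; rewrite lee_fin.
  - exact/measurable_EFinP.
  - by move=> p _; rewrite lee_fin.
  - exact/measurable_EFinP.
have hfin (P : probability (borel XX) R) : coupling mu nu P ->
  \int[P]_(p in [set: borel XX]) (h p)%:E \is a fin_num.
  by move=> cP; exact: (coupling_integral_fin C0).
have Hlim p (e1 : R) : (0 < e1)%R ->
  exists2 d, (0 < d)%R & exists N, forall (n : nat) q,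
     (N <= n)%N -> (prod_mdist p q < d)%R -> (u p - e1 <= u q)%R.
  move=> e10; have [d d0 H] := continuous_prod_mdist p cu e10.
  exists d => //; exists 0%N => n q _ /H; rewrite ltr_norml => /andP[_].
  by lra.
have [h_ hE] : exists r : R, \int[pi]_(p in [set: borel XX]) (h p)%:E = r%:E.
  by exists (fine (\int[pi]_(p in [set: borel XX]) (h p)%:E)); rewrite fineK// hfin.
have [u1 uE] : exists r : R, \int[pi]_(p in [set: borel XX]) (u p)%:E = r%:E.
  have := sumE _ cpi; rewrite hE.
  by case: (\int[pi]_(p in _) _) => // r _; exists r.
have : (u1 - e)%:E < \int[pi]_(p in [set: borel XX]) (u p)%:E.
  by rewrite uE lte_fin gtrBl.
move=> /(weakly_cvg_fatou_plans (u_ := fun _ => u)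
  (fun _ => u0) u0 (fun _ => cu) cu Hlim).
apply: filterS => n.
have := sumE _ (cpi_ n); have := hfin _ (cpi_ n); have := sumE _ cpi; rewrite hE uE.
case: (\int[pi_ n]_(p in _) (u p)%:E) => [a| |]//=;
  case: (\int[pi_ n]_(p in _) (h p)%:E) => [b| |]//=.
by rewrite -!EFinD lte_fin lee_fin => -[E1] _ [E2]; lra.
Qed.

Variables (m : {measure set (borel X) -> \bar R}) (c : R).
Hypothesis c0 : (0 < c)%R.
Hypothesis mexp :
  \int[m]_(x in [set: borel X]) (expR (- (c * sqdist x0 x)))%:E < +oo.
Variables (g : XX -> X) (C : R).
Hypothesis cg : continuous g.
Hypothesis gC : forall p,
  (sqdist x0 (g p) <= C * sqdist x0 p.1 + C * sqdist x0 p.2)%R.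

(** In the dual functional for [push (pi_ n) g] the term of [psi] converges and
    that of [V] is upper semicontinuous, so a bound on the entropies passes to
    the dual functional of the limit for each [psi]. *)
Lemma Ent_push_limit (C0 : (0 <= C)%R) (s : R) :
  (forall e : R, (0 < e)%R ->
    \forall n \near \oo, Ent m (push (pi_ n) g) <= (s + e)%:E) ->
  Ent m (push pi g) <= s%:E.
Proof.
move=> Hs.
have mg : measurable_fun [set: borel XX] (g : borel XX -> borel X).
  exact: continuous_borel_measurable.
pose V x : R := (c * sqdist x0 x)%R.
have cV : continuous V.
  by move=> x; apply: cvgM; [exact: cvg_cst|exact: sqdist_continuous].
have mV : measurable_fun [set: borel X] (V : borel X -> R).
  exact: continuous_borel_measurableR.
have V0 x : (0 <= V x)%R by rewrite mulr_ge0 ?(ltW c0) ?sqdist_ge0.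
have cVg : continuous (fun p => V (g p)).
  by move=> p; apply: continuous_comp; [exact: cg|exact: cV].
have Vg0 p : (0 <= V (g p))%R by [].
have cC0 : (0 <= c * C)%R by rewrite mulr_ge0// ltW.
have VgC p : (V (g p) <= c * C * sqdist x0 p.1 + c * C * sqdist x0 p.2)%R.
  by rewrite -!mulrA -mulrDr ler_wpM2l// ltW.
have VE (P : probability (borel XX) R) (Q : probability (borel X) R) :
    (forall A, Q A = push P g A) ->
    \int[Q]_(x in [set: borel X]) (V x)%:E =
      \int[P]_(p in [set: borel XX]) (V (g p))%:E.
  move=> QE; rewrite (same_measure_integral (nu := push P g)); last by move=> A _.
  by rewrite integral_push//; exact/measurable_EFinP.
have Vfin (P : probability (borel XX) R) : coupling mu nu P ->
  \int[P]_(p in [set: borel XX]) (V (g p))%:E \is a fin_num.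
  by move=> cP; apply: (coupling_integral_fin cC0 cP) => //;
    exact: continuous_borel_measurableR.
have [Q QE] := exists_push_probability pi mg.
rewrite -(@eq_Ent _ _ m Q); last by move=> A _.
apply: (Ent_le V0 mV mexp).
  by rewrite (VE _ _ QE) ltey_eq Vfin.
move=> psi cpsi [M psiM]; rewrite (VE _ _ QE).
apply/lee_addgt0Pr => e e0.
have e3 : (0 < e / 3)%R by rewrite divr_gt0.
have mpsi : measurable_fun [set: borel X] (psi : borel X -> R).
  exact: continuous_borel_measurableR.
have cpsig : continuous (fun p => psi (g p)).
  by move=> p; apply: continuous_comp; [exact: cg|exact: cpsi].
have psiE (P : probability (borel XX) R) (Q' : probability (borel X) R) :
    (forall A, Q' A = push P g A) ->
    \int[Q']_(x in [set: borel X]) (psi x)%:E =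
    \int[P]_(p in [set: borel XX]) (psi (g p))%:E.
  move=> Q'E; rewrite (same_measure_integral (nu := push P g)); last by move=> A _.
  by rewrite integral_push//; exact/measurable_EFinP.
have M0 : (0 <= M)%R by apply: le_trans (psiM point).
have psifin (P : probability (borel XX) R) :
    \int[P]_(p in [set: borel XX]) (psi (g p))%:E \is a fin_num.
  apply: integrable_fin_num => //.
  apply: (le_integrable measurableT _ _
    (finite_measure_integrable_cst P M measurableT)).
  - by apply/measurable_EFinP; exact: continuous_borel_measurableR.
  - by move=> x _; rewrite /= lee_fin (ger0_norm M0).
have psicv := pi_cvg cpsig (ex_intro _ M (fun p => psiM (g p))).
set Bpsi := \int[m]_(x in _) _.
have B0 : 0 <= Bpsi by apply: integral_ge0 => x _;
  rewrite lee_fin mulr_ge0 ?expR_ge0.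
have psilt : \int[pi]_(p in [set: borel XX]) (psi (g p))%:E - (e / 3)%:E <
    \int[pi]_(p in [set: borel XX]) (psi (g p))%:E.
  by rewrite lteBlDr// lteDl ?lte_fin// psifin.
have Vup := coupling_integral_upper cC0 cVg Vg0 VgC e3.
have /filter_ex[n [Hn1 [Hn2 Hn3]]] : \forall n \near \oo,
    Ent m (push (pi_ n) g) <= (s + e / 3)%:E /\
    \int[pi]_(p in [set: borel XX]) (psi (g p))%:E - (e / 3)%:E <
      \int[pi_ n]_(p in [set: borel XX]) (psi (g p))%:E /\
    \int[pi_ n]_(p in [set: borel XX]) (V (g p))%:E <=
     \int[pi]_(p in [set: borel XX]) (V (g p))%:E + (e / 3)%:E.
  apply: filterI; first exact: Hs.
  by apply: filterI => //; exact: (psicv _ (open_ereal_gt' psilt)).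
have [Qn QnE] := exists_push_probability (pi_ n) mg.
have Vnfin : \int[Qn]_(x in [set: borel X]) (V x)%:E < +oo.
  by rewrite (VE _ _ QnE) ltey_eq Vfin.
have := integral_le_Ent V0 mV mexp Vnfin mpsi psiM.
rewrite (VE _ _ QnE) (psiE _ _ QnE) (psiE _ _ QE) -/Bpsi => Hn4.
rewrite (@eq_Ent _ _ m Qn (push (pi_ n) g)) in Hn4; last by move=> A _.
move: Hn1 Hn2 Hn3 Hn4.
have := Vfin _ cpi; have := Vfin _ (cpi_ n); have := psifin pi;
  have := psifin (pi_ n).
move: B0; move: Bpsi (Ent m _).
move: (\int[pi_ n]_(p in _) (psi (g p))%:E) (\int[pi]_(p in _) (psi (g p))%:E).
move: (\int[pi_ n]_(p in _) (V (g p))%:E) (\int[pi]_(p in _) (V (g p))%:E).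
move=> [v| |] [v'| |] [a| |] [a'| |] [b| |] [E| |]//= _ _ _ _ _;
  rewrite -?EFinD -?EFinB ?lee_fin ?lte_fin ?leey//; lra.
Qed.

End limits.

(** * Convergence of the transport costs *)

Section transport_cost.
Context {R : realType} {X : completeMetricType R}.
Local Open Scope ereal_scope.
Local Notation XX := (X * X)%type.
Variable d_ : nat -> X -> X -> R.
Hypothesis d_dist : forall n, is_distance (d_ n).
Hypothesis d_metrizes : forall n, metrizes (d_ n).
Hypothesis d_cvg : locally_uniformly_cvg d_ (@mdist R X).
Variable H : R.
Hypothesis d_le : forall x y n, (d_ n x y <= H * mdist x y)%R.

Variables (x0 : X) (mu nu : probability (borel X) R).
Hypothesis mufin : \int[mu]_(x in [set: borel X]) (sqdist x0 x)%:E < +oo.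
Hypothesis nufin : \int[nu]_(x in [set: borel X]) (sqdist x0 x)%:E < +oo.

Let d_ge0 n x y : (0 <= d_ n x y)%R.
Proof. by have [] := d_dist n. Qed.

Let sqr_continuous (dist : X -> X -> R) :
  continuous (fun p : XX => dist p.1 p.2) ->
  continuous (fun p : XX => (dist p.1 p.2 ^+ 2)%R).
Proof. by move=> cd p; apply: (@cvgM R _ _ _ (fun p : XX => dist p.1 p.2));
  exact: cd. Qed.

Let d_sqr_continuous n : continuous (fun p : XX => (d_ n p.1 p.2 ^+ 2)%R).
Proof.
apply: sqr_continuous; apply: distance_continuous => // x e e0.
exact: metrizes_near.
Qed.

Let mdist_sqr_continuous : continuous (fun p : XX => (mdist p.1 p.2 ^+ 2)%R).
Proof. by apply: sqr_continuous; exact: mdist_continuous. Qed.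

Let mdist_sqr_le (p : XX) :
  (mdist p.1 p.2 ^+ 2 <= 2 * sqdist x0 p.1 + 2 * sqdist x0 p.2)%R.
Proof.
have := sqdist_triangle p.2 x0 p.1.
by rewrite /sqdist (metric_sym x0 p.2).
Qed.

Let d_sqr_le_mdist n (p : XX) :
  (d_ n p.1 p.2 ^+ 2 <= H ^+ 2 * mdist p.1 p.2 ^+ 2)%R.
Proof.
have d0 := d_ge0 n p.1 p.2; have dH := d_le p.1 p.2 n.
by rewrite -exprMn lerXn2r// nnegrE// (le_trans d0).
Qed.

Let d_sqr_le n (p : XX) : (d_ n p.1 p.2 ^+ 2 <=
  H ^+ 2 * 2 * sqdist x0 p.1 + H ^+ 2 * 2 * sqdist x0 p.2)%R.
Proof.
apply: (le_trans (d_sqr_le_mdist n p)).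
have -> : (H ^+ 2 * 2 * sqdist x0 p.1 + H ^+ 2 * 2 * sqdist x0 p.2 =
  H ^+ 2 * (2 * sqdist x0 p.1 + 2 * sqdist x0 p.2))%R by ring.
by apply: ler_wpM2l; [exact: sqr_ge0|exact: mdist_sqr_le].
Qed.

Lemma cost_fin n (pi : probability (borel XX) R) : coupling mu nu pi ->
  cost (d_ n) pi \is a fin_num.
Proof.
move=> cpi; apply: (@coupling_integral_fin _ _ x0 mu nu mufin nufin (H ^+ 2 * 2)%R).
- by rewrite mulr_ge0 ?sqr_ge0.
- by [].
- by apply: continuous_borel_measurableR; exact: d_sqr_continuous.
- by move=> p; exact: sqr_ge0.
- exact: d_sqr_le.
Qed.

Lemma mdist_cost_fin (pi : probability (borel XX) R) : coupling mu nu pi ->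
  cost (@mdist R X) pi \is a fin_num.
Proof.
move=> cpi; apply: (@coupling_integral_fin _ _ x0 mu nu mufin nufin 2%R) => //.
- by apply: continuous_borel_measurableR; exact: mdist_sqr_continuous.
- by move=> p; exact: sqr_ge0.
Qed.

Lemma cvg_cost (pi : probability (borel XX) R) : coupling mu nu pi ->
  cost (d_ n) pi @[n --> \oo] --> cost (@mdist R X) pi.
Proof.
move=> cpi; rewrite /cost.
have md n : measurable_fun [set: borel XX] (fun p : borel XX =>
  (d_ n p.1 p.2 ^+ 2)%:E).
  apply/measurable_EFinP; apply: continuous_borel_measurableR.
  exact: d_sqr_continuous.
have mm : measurable_fun [set: borel XX] (fun p : borel XX =>
  (mdist p.1 p.2 ^+ 2)%:E).
  apply/measurable_EFinP; apply: continuous_borel_measurableR.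
  exact: mdist_sqr_continuous.
apply: (@dominated_cvg _ (borel XX) R pi [set: borel XX] measurableT
  (fun n (p : borel XX) => (d_ n p.1 p.2 ^+ 2)%:E)
  (fun p : borel XX => (mdist p.1 p.2 ^+ 2)%:E)
  (fun p : borel XX => (H ^+ 2)%:E * (mdist p.1 p.2 ^+ 2)%:E)).
- exact: md.
- move=> p _; apply: cvg_EFin; first exact: nearW.
  have c := @cvg_distance _ _ _ d_cvg p.
  exact: (@cvgM R _ _ _ (fun n => d_ n p.1 p.2) (fun n => d_ n p.1 p.2)).
- by [].
- apply: integrableZl => //; apply/integrableP; split; first exact: mm.
  under eq_integral do rewrite gee0_abs ?lee_fin ?sqr_ge0//.
  by rewrite ltey_eq (mdist_cost_fin cpi).
- move=> n p _; rewrite -EFinM abse_EFin lee_fin ger0_norm ?sqr_ge0//.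
Qed.

Variables (pi_ : nat -> probability (borel XX) R) (pi : probability (borel XX) R).
Variable phi : nat -> nat.
Hypothesis phi_mono : {homo phi : i j / (i < j)%N}.
Hypothesis pi_cvg : weakly_cvg (fun n => pi_ (phi n)) pi.
Hypothesis pi_opt : forall n, OptPlans (d_ n) mu nu (pi_ n).
Hypothesis opt : OptPlans (@mdist R X) mu nu pi.

Let phi_ge n : (n <= phi n)%N.
Proof. by elim: n => // n ih; exact: leq_ltn_trans ih (phi_mono (ltnSn n)). Qed.

(** Upper bound: [pi] competes with [pi_ (phi n)], and its costs converge.  Lower
    bound: Fatou's lemma for the squared distances. *)
Lemma W2sq_cvg : exists w : R, W2sq (@mdist R X) mu nu = w%:E /\
  forall e : R, (0 < e)%R -> \forall n \near \oo,
    exists2 wn : R, W2sq (d_ (phi n)) mu nu = wn%:E & (`|wn - w| <= e)%R.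
Proof.
have [cpi _] := opt; have cpi_ n : coupling mu nu (pi_ n) by have [] := pi_opt n.
rewrite (W2sq_opt opt).
pose w := fine (cost (@mdist R X) pi).
have wE : cost (@mdist R X) pi = w%:E by rewrite fineK// mdist_cost_fin.
exists w; split => // e e0.
have low : \forall n \near \oo, (w - e)%:E < cost (d_ (phi n)) (pi_ (phi n)).
  apply: (weakly_cvg_fatou_plans pi_cvg (u_ := fun n p =>
    (d_ (phi n) p.1 p.2 ^+ 2)%R)
    (u := fun p => (mdist p.1 p.2 ^+ 2)%R)).
  - by move=> n p; exact: sqr_ge0.
  - by move=> p; exact: sqr_ge0.
  - by move=> n; exact: d_sqr_continuous.
  - exact: mdist_sqr_continuous.
  - by move=> p e1 e10; apply: sqr_distance_lower_bound.
  - by rewrite -/(cost _ _) wE lte_fin gtrBl.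
have up : \forall n \near \oo, cost (d_ (phi n)) pi < (w + e)%:E.
  have : cost (@mdist R X) pi < (w + e)%:E by rewrite wE lte_fin ltrDl.
  move=> /open_ereal_lt'/(cvg_cost cpi)[N _ HN].
  by exists N => // n Nn; apply: HN; exact: leq_trans Nn (phi_ge n).
near=> n; rewrite (W2sq_opt (pi_opt (phi n))).
have h1 : (w - e)%:E < cost (d_ (phi n)) (pi_ (phi n)) by near: n.
have h2 : cost (d_ (phi n)) pi < (w + e)%:E by near: n.
have [_ /(_ pi cpi) h3] := pi_opt (phi n).
have f := cost_fin (phi n) (cpi_ (phi n)).
exists (fine (cost (d_ (phi n)) (pi_ (phi n)))); first by rewrite fineK.
move: h1 (le_lt_trans h3 h2); rewrite -(fineK f) !lte_fin => h4 h5.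
by rewrite ler_norml; apply/andP; split; lra.
Unshelve. all: by end_near. Qed.

Variables (m : {measure set (borel X) -> \bar R}) (c : R).
Hypothesis c0 : (0 < c)%R.
Hypothesis mexp :
  \int[m]_(x in [set: borel X]) (expR (- (c * sqdist x0 x)))%:E < +oo.
Variables (g : XX -> X) (C : R).
Hypothesis C0 : (0 <= C)%R.
Hypothesis cg : continuous g.
Hypothesis gC : forall p,
  (sqdist x0 (g p) <= C * sqdist x0 p.1 + C * sqdist x0 p.2)%R.

(** The sign of [k] is arbitrary, which is why the costs have to converge and not
    merely be semicontinuous. *)
Lemma Ent_interpolation_limit (a k : R) :
  (forall n, Ent m (push (pi_ n) g) <= a%:E - k%:E * W2sq (d_ n) mu nu) ->
  Ent m (push pi g) <= a%:E - k%:E * W2sq (@mdist R X) mu nu.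
Proof.
move=> Hn; have [w [-> W]] := W2sq_cvg.
have cpi_ n : coupling mu nu (pi_ (phi n)) by have [] := pi_opt (phi n).
have [cpi _] := opt.
rewrite -EFinM -EFinB.
apply: (Ent_push_limit mufin nufin pi_cvg cpi_ cpi c0 mexp cg gC C0) => e e0.
have k1 : (0 < `|k| + 1)%R by rewrite ltr_wpDl.
have ek : (0 < e / (`|k| + 1))%R by rewrite divr_gt0.
have := W _ ek; apply: filterS => n [wn wnE wnw].
apply: (le_trans (Hn (phi n))); rewrite wnE -EFinM -EFinB lee_fin.
have : (`|k| * `|wn - w| <= e)%R.
  apply: (@le_trans _ _ (`|k| * (e / (`|k| + 1)))%R); first by rewrite ler_wpM2l.
  by rewrite mulrCA ler_piMr ?(ltW e0)// ler_pdivrMr// mul1r lerDl.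
rewrite -normrM ler_norml => /andP[+ _]; rewrite mulrBr.
by lra.
Qed.

End transport_cost.

(** * Paths and consistent geodesic flows *)

Section paths.
Context {R : realType} {X : completeMetricType R}.

(** Singletons are compact, so evaluations are continuous for the compact-open
    topology. *)
Lemma evaluation_continuous (t : I01 R) : continuous (e_ t : C01 R X -> X).
Proof.
apply/continuousP => U oU.
pose h (g : C01 R X) : {compact-open, I01 R -> X} :=
  (g : continuousType (I01 R) X).
have ch : continuous h by exact: initial_continuous.
have -> : (e_ t : C01 R X -> X) @^-1` U =
    h @^-1` [set f : {compact-open, I01 R -> X} | f @` [set t] `<=` U].
  apply/seteqP; split => g /=.
    by move=> gU _ [_ -> <-].
  by apply; exists t.
apply: open_comp => [g _|]; first exact: ch.
by apply: compact_open_open => //; exact: compact_set1.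
Qed.

Lemma affine_0 (s t : I01 R) : affine s t I01_0 = s.
Proof. by apply: val_inj => /=; rewrite subr0 mul1r mul0r addr0. Qed.

Lemma affine_1 (s t : I01 R) : affine s t I01_1 = t.
Proof. by apply: val_inj => /=; rewrite subrr mul0r mul1r add0r. Qed.

Lemma e_restr (s t r : I01 R) (g : C01 R X) :
  e_ r (restr s t g) = e_ (affine s t r) g.
Proof. by []. Qed.

Lemma continuous_subZ (T : topologicalType) (c : R) (f g : T -> R) :
  continuous f -> continuous g -> continuous (fun x => f x - c * g x).
Proof.
move=> cf cg x; apply: (@cvgB R R^o); first exact: cf.
by apply: cvgM; [exact: cvg_cst|exact: cg].
Qed.

Lemma Geo_closed : closed (Geo (@mdist R X)).
Proof.
have -> : Geo (@mdist R X) = \bigcap_(st : I01 R * I01 R)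
   (fun g : C01 R X => mdist (e_ st.1 g) (e_ st.2 g) -
      `|\val st.1 - \val st.2| * mdist (e_ I01_0 g) (e_ I01_1 g)) @^-1` [set 0].
  apply/seteqP; split => g /=.
    by move=> gG [s t] _ /=; rewrite gG subrr.
  by move=> H s t; apply/eqP; rewrite -subr_eq0; apply/eqP; exact: (H (s, t)).
apply: closed_bigI => -[s t] _ /=.
have cm (a b : I01 R) : continuous (fun g : C01 R X => mdist (e_ a g) (e_ b g)).
  move=> g; apply: (@continuous_comp _ _ _ (fun g : C01 R X => (e_ a g, e_ b g))
    (fun p => mdist p.1 p.2)); last exact: mdist_continuous.
  apply: cvg_pair => //; [exact: (nbhs_filter g)|..].
    exact: (@evaluation_continuous a g).
  exact: (@evaluation_continuous b g).
apply: preimage_closed; last exact: closed_eq.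
move=> g _.
have H := @continuous_subZ _ `|\val s - \val t| _ _ (cm s t) (cm I01_0 I01_1) g.
exact: H.
Qed.

Lemma measurable_Geo : measurable (Geo (@mdist R X) : set (borel (C01 R X))).
Proof.
rewrite -[X in measurable X]setCK; apply: measurableC.
by apply: sub_sigma_algebra; exact: closed_openC Geo_closed.
Qed.

Lemma Geo_mdist (g : C01 R X) (s t : I01 R) : Geo (@mdist R X) g ->
  mdist (e_ s g) (e_ t g) = `|\val s - \val t| * mdist (e_ I01_0 g) (e_ I01_1 g).
Proof. by move=> /(_ s t). Qed.

End paths.

(** The real-number part of the next approximation argument: the interval
    [[s, t]] is shrunk by a proportion [z] at both ends, which moves interior
    points by at most [z]. *)
Lemma shrink_interval {R : realType} (s t r z : R) :
  0 <= s -> s < t -> t <= 1 -> 0 <= r -> r <= 1 -> 0 < z -> z < 2^-1 ->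
  let s' := s + z * (t - s) in let t' := t - z * (t - s) in
  [/\ 0 < s', s' < t' & t' < 1] /\
  [/\ `|s - s'| <= z, `|t - t'| <= z &
     `|((1 - r) * s + r * t) - ((1 - r) * s' + r * t')| <= z].
Proof.
move=> s0 st t1 r0 r1 z0 z2 /=.
have v0 : 0 < z * (t - s) by rewrite mulr_gt0// subr_gt0.
have vz : z * (t - s) <= z by rewrite ler_piMr ?(ltW z0)//; lra.
have v2 : z * (t - s) < 2^-1 * (t - s) by rewrite ltr_pM2r// subr_gt0.
move: (z * (t - s)) v0 vz v2 => v v0 vz v2.
split; first by split; lra.
have sv : `|s - (s + v)| <= z by rewrite ler_norml; apply/andP; split; lra.
have tv : `|t - (t - v)| <= z by rewrite ler_norml; apply/andP; split; lra.
split => //.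
have -> : (1 - r) * s + r * t - ((1 - r) * (s + v) + r * (t - v)) =
  (2 * r - 1) * v by ring.
rewrite normrM (ger0_norm (ltW v0)) (le_trans _ vz)// ler_piMl ?(ltW v0)//.
by rewrite ler_norml; apply/andP; split; lra.
Qed.

Section flow.
Context {R : realType} {X : completeMetricType R}.
Variable G : X * X -> C01 R X.
Hypothesis Gflow : consistent_geodesic_flow (@mdist R X) G.
Hypothesis Glip : Lipschitz_flow (@mdist R X) G.

Let G_Geo p : Geo (@mdist R X) (G p).
Proof. by case: p => x y; have [_ /(_ x y)[]] := Gflow. Qed.

Let G0 p : e_ I01_0 (G p) = p.1.
Proof. by case: p => x y; have [_ /(_ x y)[]] := Gflow. Qed.

Let G1 p : e_ I01_1 (G p) = p.2.
Proof. by case: p => x y; have [_ /(_ x y)[]] := Gflow. Qed.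

Lemma flow_mdist s t p :
  mdist (e_ s (G p)) (e_ t (G p)) = `|\val s - \val t| * mdist p.1 p.2.
Proof. by rewrite (Geo_mdist _ _ (G_Geo p)) G0 G1. Qed.

Lemma flow_lipschitz : exists2 L : R, 0 <= L & forall t p q,
  mdist (e_ t (G p)) (e_ t (G q)) <= L * prod_mdist p q.
Proof.
have [L HL] := Glip; exists `|L| => // t [x1 y1] [x2 y2].
apply: (le_trans (HL x1 x2 y1 y2 t)).
apply: (le_trans (ler_wpM2r (sqrtr_ge0 _) (ler_norm L))).
rewrite ler_wpM2l// -[leRHS]ger0_norm ?prod_mdist_ge0// -sqrtr_sqr.
rewrite ler_wsqrtr// /prod_mdist sqrrD/= lerD2r lerDl mulrn_wge0//.
by rewrite mulr_ge0 ?mdist_ge0.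
Qed.

Lemma flow_continuous t : continuous (fun p => e_ t (G p)).
Proof.
have [L L0 HL] := flow_lipschitz; move=> p;
  apply/metricType_numDomainType.cvgrPdist_lt => e e0.
have eL : 0 < e / (L + 1) by rewrite divr_gt0// ltr_wpDl.
apply: filterS (near_prod_mdist p eL) => q pq.
apply: (le_lt_trans (HL t p q)).
rewrite ltr_pdivlMr ?ltr_wpDl// in pq; apply: le_lt_trans pq.
by rewrite [leRHS]mulrDr mulr1 mulrC lerDl prod_mdist_ge0.
Qed.

(** Along a geodesic, [d(x0, G_t(x, y)) <= 2 d(x0, x) + d(x0, y)]. *)
Lemma flow_sqdist x0 t p :
  sqdist x0 (e_ t (G p)) <= 8 * sqdist x0 p.1 + 8 * sqdist x0 p.2.
Proof.
have := flow_mdist I01_0 t p; rewrite G0 /= sub0r normrN => E.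
have /andP[t0 t1] := I01_bounds t; rewrite ger0_norm// in E.
have h1 : mdist p.1 (e_ t (G p)) <= mdist p.1 p.2.
  by rewrite E ler_piMl// mdist_ge0.
rewrite /sqdist.
have := metric_triangle (e_ t (G p)) p.1 x0; rewrite (metric_sym _ p.1).
have := metric_triangle p.1 x0 p.2; rewrite (metric_sym x0).
have := @mdist_ge0 R X (e_ t (G p)) x0; have := @mdist_ge0 R X p.1 x0.
have := @mdist_ge0 R X p.2 x0.
move: h1; move: (mdist (e_ _ _) _) (mdist p.1 (e_ _ _)) (mdist p.1 x0)
  (mdist p.2 x0) (mdist p.1 p.2).
move=> a b c d f h1 d0 c0 a0 h2 h3.
have cd0 : 0 <= 2 * c + d by lra.
have acd : a <= 2 * c + d by lra.
have : a ^+ 2 <= (2 * c + d) ^+ 2 by rewrite lerXn2r// nnegrE.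
have : 0 <= (2 * c - d) ^+ 2 by exact: sqr_ge0.
have : 0 <= d ^+ 2 by exact: sqr_ge0.
by rewrite sqrrB sqrrD !exprMn; lra.
Qed.

(** Consistency is only assumed for [0 < s] and [t < 1].  Both sides depend
    continuously on [s] and [t], as [G] is Lipschitz, so the general case
    follows by shrinking the interval. *)
Lemma flow_consistent s t r p : \val s < \val t ->
  e_ r (restr s t (G p)) = e_ r (G (e_ s (G p), e_ t (G p))).
Proof.
move=> st; have [L L0 HL] := flow_lipschitz.
apply: mdist_positivity; apply/eqP; rewrite eq_le mdist_ge0 andbT.
set D := mdist p.1 p.2; have D0 : 0 <= D by exact: mdist_ge0.
suff bnd (z : R) : 0 < z -> z < 2^-1 ->
    mdist (e_ r (restr s t (G p))) (e_ r (G (e_ s (G p), e_ t (G p)))) <=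
    (1 + 2 * L) * D * z.
  apply/ler_addgt0Pr => e e0; rewrite add0r.
  pose M := (1 + 2 * L) * D + 1.
  have M0 : 0 < M by rewrite ltr_wpDl// mulr_ge0// addr_ge0// mulr_ge0.
  have z0 : 0 < Num.min (e / M) (4^-1) by rewrite lt_min divr_gt0// invr_gt0 ltr0n.
  apply: (le_trans (bnd _ z0 _)).
    by rewrite gt_min; apply/orP; right; lra.
  apply: (@le_trans _ _ (M * (e / M))); last by rewrite mulrC divfK// gt_eqF.
  apply: ler_pM => //; first by rewrite mulr_ge0// addr_ge0// mulr_ge0.
  - exact: ltW.
  - by rewrite /M lerDl.
  - by rewrite ge_min lexx.
move=> z0 z2.
have /andP[s0 s1] := I01_bounds s; have /andP[t0 t1] := I01_bounds t.
have /andP[r0 r1] := I01_bounds r.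
have zI : z \in (`[0, 1]%classic : set R).
  by rewrite mem_set//= in_itv/= (ltW z0)/=; lra.
have zI' : 1 - z \in (`[0, 1]%classic : set R).
  by rewrite mem_set//= in_itv/= subr_ge0 lerBlDr lerDl (ltW z0) andbT; lra.
have [s' s'E] : exists s' : I01 R, \val s' = \val s + z * (\val t - \val s).
  by exists (affine s t (exist _ z zI)) => /=; ring.
have [t' t'E] : exists t' : I01 R, \val t' = \val t - z * (\val t - \val s).
  by exists (affine s t (exist _ (1 - z) zI')) => /=; ring.
have := shrink_interval s0 st t1 r0 r1 z0 z2; rewrite /= -s'E -t'E.
move=> [[s'0 st' t'1] [ss' tt' rr']].
have [_ _ /(_ s' t' s'0 st' t'1 p.1 p.2)] := Gflow.
rewrite -surjective_pairing => Gst.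
apply: (le_trans (metric_triangle _ (e_ r (restr s' t' (G p))) _)).
have -> : (1 + 2 * L) * D * z = z * D + L * (z * D + z * D) by ring.
apply: lerD; first by rewrite !e_restr flow_mdist ler_wpM2r.
rewrite Gst; apply: (le_trans (HL _ _ _)); rewrite ler_wpM2l// /prod_mdist.
rewrite !flow_mdist -/D (distrC (\val s')) (distrC (\val t')).
by apply: lerD; rewrite ler_wpM2r.
Qed.

End flow.

(** * Convexity of the entropy along restricted plans *)

Section measure_facts.
Context {R : realType} {X : completeMetricType R}.
Local Open Scope ereal_scope.

Lemma eq_coupling (mu nu mu' nu' : set (borel X) -> \bar R) pi :
  same_measure mu mu' -> same_measure nu nu' ->
  coupling mu nu pi -> coupling mu' nu' pi.
Proof.
by move=> mm nn [h1 h2]; split => A mA; [rewrite h1// mm|rewrite h2// nn].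
Qed.

Lemma eq_W2sq (dist : X -> X -> R) (mu nu mu' nu' : set (borel X) -> \bar R) :
  same_measure mu mu' -> same_measure nu nu' ->
  W2sq dist mu nu = W2sq dist mu' nu'.
Proof.
move=> mm nn; rewrite /W2sq.
have -> // : [set pi : probability (borel (X * X)%type) R | coupling mu nu pi] =
  [set pi : probability (borel (X * X)%type) R | coupling mu' nu' pi].
apply/seteqP; split => pi /=; first exact: eq_coupling.
by apply: eq_coupling => A mA; [rewrite mm|rewrite nn].
Qed.

Lemma density_null_dominates (m : {measure set (borel X) -> \bar R})
    (mu : probability (borel X) R) rho : is_density m mu rho -> mu `<< m.
Proof.
move=> [mrho rho0 murho]; apply/null_content_dominatesP => A mA mA0.
rewrite murho// /weighted setIT -[RHS](@integral_abs_eq0 _ _ _ m A (EFin \o rho))//.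
  by apply: eq_integral => x _; rewrite /= ger0_norm.
by apply/measurable_EFinP; exact: measurable_funS mrho.
Qed.

(** Young's inequality with [psi = 0]. *)
Lemma Ent_gtNy (m : {measure set (borel X) -> \bar R}) (x0 : X) (c : R)
    (mu : probability (borel X) R) : (0 < c)%R ->
  \int[m]_(x in [set: borel X]) (expR (- (c * sqdist x0 x)))%:E < +oo ->
  \int[mu]_(x in [set: borel X]) (sqdist x0 x)%:E < +oo ->
  -oo < Ent m mu.
Proof.
move=> c0 mexp mufin.
have V0 x : (0 <= c * sqdist x0 x)%R by rewrite mulr_ge0 ?(ltW c0) ?sqdist_ge0.
have mV : measurable_fun [set: borel X] (fun x : borel X => c * sqdist x0 x : R)%R.
  by apply: measurable_funM => //; apply/measurable_EFinP; exact: measurable_sqdist.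
have Vfin : \int[mu]_(x in [set: borel X]) (c * sqdist x0 x)%:E < +oo.
  under eq_integral do rewrite EFinM.
  rewrite ge0_integralZl ?lee_fin ?(ltW c0)//.
  - exact: lte_mul_pinfty (ltW _) _ _.
  - exact: measurable_sqdist.
  - by move=> x _; rewrite lee_fin sqdist_ge0.
have c0k (x : borel X) : (`|cst 0 x : R| <= 0)%R by rewrite normr0.
have := integral_le_Ent V0 mV mexp Vfin (measurable_cst _) c0k.
rewrite [X in X <= _](_ : _ = 0); last exact: integral0.
by case: (Ent m mu) => [r _|//|]; rewrite ?ltNyr// addNye leeNy_eq.
Qed.

End measure_facts.

Section restricted_plans.
Context {R : realType} {X : completeMetricType R}.
Local Open Scope ereal_scope.
Local Notation XX := (X * X)%type.
Variables (m : {measure set (borel X) -> \bar R}) (K : R).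
Variables (d_ : nat -> X -> X -> R) (G : XX -> C01 R X).
Variable Pi : probability (borel X) R -> probability (borel X) R ->
  probability (borel XX) R.
Variables (x0 : X) (c H : R).
Hypothesis c0 : (0 < c)%R.
Hypothesis mexp :
  \int[m]_(x in [set: borel X]) (expR (- (c * sqdist x0 x)))%:E < +oo.
Hypothesis d_dist : forall n, is_distance (d_ n).
Hypothesis d_metrizes : forall n, metrizes (d_ n).
Hypothesis d_cvg : locally_uniformly_cvg d_ (@mdist R X).
Hypothesis d_le : forall x y n, (d_ n x y <= H * mdist x y)%R.
Hypothesis Gflow : consistent_geodesic_flow (@mdist R X) G.
Hypothesis Glip : Lipschitz_flow (@mdist R X) G.
Hypothesis selection : consistent_plan_selection (@mdist R X) m G Pi.
Hypothesis approximation : forall mu nu : probability (borel X) R,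
  Pac (@mdist R X) m mu -> Pac (@mdist R X) m nu ->
  exists pi_ : nat -> probability (borel XX) R,
    [/\ forall n, OptPlans (d_ n) mu nu (pi_ n),
        exists2 phi : nat -> nat, {homo phi : i j / (i < j)%N} &
          weakly_cvg (fun n => pi_ (phi n)) (Pi mu nu) &
        forall (n : nat) (t : I01 R),
          Ent m (push (pi_ n) (e_ t \o G)) <=
            (1 - \val t)%:E * Ent m mu + (\val t)%:E * Ent m nu
            - (K / 2 * \val t * (1 - \val t))%:E * W2sq (d_ n) mu nu].

Variables mu0 mu1 : probability (borel X) R.
Hypothesis mu0ac : Pac (@mdist R X) m mu0.
Hypothesis mu1ac : Pac (@mdist R X) m mu1.
Variables (t0 t1 : I01 R) (f : borel XX -> R) (M : R).
Hypothesis t01 : (\val t0 < \val t1)%R.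
Hypothesis mf : measurable_fun [set: borel XX] f.
Hypothesis f0 : forall p, (0 <= f p)%R.
Hypothesis fM : forall p, (f p <= M)%R.
Hypothesis f1 : \int[Pi mu0 mu1]_(p in [set: borel XX]) (f p)%:E = 1.

Let fPi := weighted (Pi mu0 mu1) [set: borel XX] f.
Let h t (p : XX) : X := e_ t (G p).

Let ch t : continuous (h t). Proof. exact: (flow_continuous Glip). Qed.

Let mh t : measurable_fun [set: borel XX] (h t : borel XX -> borel X).
Proof. by apply: continuous_borel_measurable; exact: ch. Qed.

Let exists_fPi : exists F : probability (borel XX) R, forall A, F A = fPi A.
Proof.
have [nu nuE] := exists_weighted (Pi mu0 mu1) mf f0.
have nu1 : nu [set: borel XX] = 1 by rewrite nuE /weighted setIT.
by have [F FE] := exists_probability nu1; exists F => A; rewrite FE nuE.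
Qed.

Let Pi_coupling : coupling mu0 mu1 (Pi mu0 mu1).
Proof. by have [/(_ _ _ mu0ac mu1ac)[]] := selection. Qed.

Let push_second_moment t (mu : probability (borel X) R) :
  (forall A, mu A = push fPi (h t) A) ->
  \int[mu]_(x in [set: borel X]) (sqdist x0 x)%:E < +oo.
Proof.
move=> muE; rewrite (same_measure_integral (nu := push fPi (h t)));
  last by move=> A _.
have [nu nuE] := exists_weighted (Pi mu0 mu1) mf f0.
rewrite /fPi -nuE integral_push; [|exact: mh|exact: measurable_sqdist].
have mg : measurable_fun [set: borel XX] (fun p : borel XX =>
  (sqdist x0 (h t p))%:E).
  apply/measurable_EFinP; apply: continuous_borel_measurableR => p.
  by apply: continuous_comp; [exact: ch|exact: sqdist_continuous].
have g0 (p : borel XX) : 0 <= (sqdist x0 (h t p))%:E by rewrite lee_fin sqdist_ge0.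
rewrite nuE ge0_integral_weighted//.
have M0 : (0 <= M)%R by apply: le_trans (fM point).
apply: (@le_lt_trans _ _ (\int[Pi mu0 mu1]_(p in [set: borel XX])
    (M%:E * (sqdist x0 (h t p))%:E))).
  apply: ge0_le_integral => //.
  - by move=> p _; rewrite mule_ge0// lee_fin.
  - by apply: emeasurable_funM => //; exact/measurable_EFinP.
  - exact: emeasurable_funM.
  - by move=> p _; rewrite muleC lee_wpmul2r// lee_fin.
rewrite ge0_integralZl//; apply: lte_mul_pinfty => //.
have [[P0 _] [P1 _]] := (mu0ac, mu1ac).
rewrite ltey_eq; apply/orP; left.
apply: (coupling_integral_fin (P2_base x0 P0) (P2_base x0 P1) (C := 8) _
  Pi_coupling) => //.
- exact/measurable_EFinP.
- by move=> p; exact: (flow_sqdist Gflow).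
Qed.

(** When both end marginals have finite entropy they are in [Pac], the two
    consistency properties identify the restricted plan with the selected plan
    between them, and the approximating plans can be used. *)
Lemma restricted_entropy_convexity t :
  Ent m (push fPi (e_ (affine t0 t1 t) \o G)) <=
    (1 - \val t)%:E * Ent m (push fPi (e_ t0 \o G))
    + (\val t)%:E * Ent m (push fPi (e_ t1 \o G))
    - (K / 2 * \val t * (1 - \val t))%:E *
      W2sq (@mdist R X) (push fPi (e_ t0 \o G)) (push fPi (e_ t1 \o G)).
Proof.
have [F FE] := exists_fPi.
have pushE t' A : push F (h t') A = push fPi (h t') A by exact: FE.
have [mu muE'] := exists_push_probability F (mh t0).
have [nu nuE'] := exists_push_probability F (mh t1).
have muE A : mu A = push fPi (h t0) A by rewrite muE'.
have nuE A : nu A = push fPi (h t1) A by rewrite nuE'.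
have mhh : measurable_fun [set: borel XX] ((fun p => (h t0 p, h t1 p)) :
  borel XX -> borel XX).
  apply: continuous_borel_measurable => p.
  by apply: cvg_pair => //; exact: ch.
(* the restricted plan itself shows that [W_2(mu, nu)] is finite *)
have [gam gamE] := exists_push_probability F mhh.
have cgam : coupling mu nu gam.
  split => A mA; rewrite /push /pushforward; rewrite [LHS]gamE.
    by rewrite muE'.
  by rewrite nuE'.
have mufin := push_second_moment muE.
have nufin := push_second_moment nuE.
have smu : same_measure mu (push fPi (e_ t0 \o G)) by move=> A _; exact: muE.
have snu : same_measure nu (push fPi (e_ t1 \o G)) by move=> A _; exact: nuE.
have W0 : 0 <= W2sq (@mdist R X) mu nu.
  apply: le_ereal_inf_tmp => _ [pi _ <-].
  by apply: integral_ge0 => p _; rewrite lee_fin sqr_ge0.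
have Wfin : W2sq (@mdist R X) mu nu \is a fin_num.
  rewrite ge0_fin_numE//; apply: (@le_lt_trans _ _ (cost (@mdist R X) gam)).
    by apply: ereal_inf_lbound; exists gam.
  by rewrite ltey_eq (mdist_cost_fin mufin nufin cgam).
rewrite -(eq_W2sq _ smu snu) -(eq_Ent _ smu) -(eq_Ent _ snu).
(* at the end points the infinite entropies are multiplied by [0] *)
have [t0'|tn0] := eqVneq (\val t) 0%R.
  rewrite t0' mulr0 mul0r !mul0e subr0 mul1e sube0 adde0.
  by rewrite (_ : t = I01_0) ?affine_0 -?(eq_Ent _ smu)//; apply: val_inj;
    rewrite t0'.
have [t1'|tn1] := eqVneq (\val t) 1%R.
  rewrite t1' subrr mulr0 !mul0e mul1e sube0 add0e.
  by rewrite (_ : t = I01_1) ?affine_1 -?(eq_Ent _ snu)//; apply: val_inj;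
    rewrite t1'.
have /andP[tge0 tle1] := I01_bounds t.
have tgt0 : (0 < \val t)%R by rewrite lt_neqAle eq_sym tn0.
have tlt1 : (\val t < 1)%R by rewrite lt_neqAle tn1.
have muNy := Ent_gtNy c0 mexp mufin; have nuNy := Ent_gtNy c0 mexp nufin.
have kW : (K / 2 * \val t * (1 - \val t))%:E * W2sq (@mdist R X) mu nu \is a
  fin_num.
  by rewrite fin_numM.
have kWNy : - ((K / 2 * \val t * (1 - \val t))%:E * W2sq (@mdist R X) mu nu) != -oo.
  by move: kW; case: (_ * _).
have [Emu|Emu] := eqVneq (Ent m mu) +oo.
  rewrite Emu gt0_muley ?lte_fin ?subr_gt0// addye.
    by rewrite addye ?leey.
  by case: (Ent m nu) nuNy => // [_]; rewrite gt0_muley ?lte_fin.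
have [Enu|Enu] := eqVneq (Ent m nu) +oo.
  rewrite Enu gt0_muley ?lte_fin// addey.
    by rewrite addye ?leey.
  by case: (Ent m mu) muNy => // [_]; rewrite gt0_muley ?lte_fin ?subr_gt0.
have [[rho drho _]|[_ E]] := EntP m mu; last by rewrite E eqxx in Emu.
have [[rho' drho' _]|[_ E]] := EntP m nu; last by rewrite E eqxx in Enu.
have muac : Pac (@mdist R X) m mu by split;
  [exists x0|exact: density_null_dominates drho].
have nuac : Pac (@mdist R X) m nu by split;
  [exists x0|exact: density_null_dominates drho'].
have f_bd : exists M, forall p, (f p <= M)%R by exists M.
have sPi := selection.2 mu0 mu1 mu0ac mu1ac t0 t1 t01 f mf f0 f_bd f1 mu nu
  smu snu muac nuac.
have [pi_ [optn [phi phi_mono pi_cvg] conv]] := approximation muac nuac.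
have opt := selection.1 _ _ muac nuac.
have -> : Ent m (push fPi (e_ (affine t0 t1 t) \o G)) =
  Ent m (push (Pi mu nu) (e_ t \o G)).
  apply: eq_Ent => A mA.
  rewrite [RHS]/push /pushforward -sPi; last first.
    by rewrite -[X in measurable X]setTI; exact: mh.
  rewrite /push /pushforward; congr (weighted _ _ _ _).
  apply/seteqP; split => p /=; rewrite -(flow_consistent Gflow Glip t p t01)//.
pose a := ((1 - \val t) * fine (Ent m mu) + \val t * fine (Ent m nu))%R.
have aE : (1 - \val t)%:E * Ent m mu + (\val t)%:E * Ent m nu = a%:E.
  by rewrite /a [RHS]EFinD !EFinM !fineK// fin_numE ?Emu ?Enu gt_eqF.
rewrite aE.
have cg : continuous (e_ t \o G) by exact: ch.
have gC p : (sqdist x0 ((e_ t \o G) p) <= 8 * sqdist x0 p.1 + 8 * sqdist x0 p.2)%R.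
  exact: (flow_sqdist Gflow).
have H1 := Ent_interpolation_limit d_dist d_metrizes d_cvg d_le mufin nufin phi_mono
  pi_cvg optn opt c0 mexp (ler0n R 8) cg gC.
by apply: H1 => n; rewrite -aE; exact: conv.
Qed.

End restricted_plans.

(** * The very strict CD condition *)

Theorem proposition2p8 (R : realType) (X : completeMetricType R)
    (m : {measure set (borel X) -> \bar R}) (K : R)
    (d_ : nat -> X -> X -> R) (G : X * X -> C01 R X)
    (Pi : probability (borel X) R -> probability (borel X) R ->
          probability (borel (X * X)%type) R) :
  metric_measure_space m ->
  locally_compact [set: X] ->
  (forall n, is_distance (d_ n)) ->
  (forall n, metrizes (d_ n)) ->
  locally_uniformly_cvg d_ (@mdist R X) ->
  (exists H : R, forall x y n, d_ n x y <= H * mdist x y) ->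
  consistent_geodesic_flow (@mdist R X) G ->
  Lipschitz_flow (@mdist R X) G ->
  (forall n, consistent_geodesic_flow (d_ n) G) ->
  consistent_plan_selection (@mdist R X) m G Pi ->
  (forall mu nu : probability (borel X) R,
    Pac (@mdist R X) m mu -> Pac (@mdist R X) m nu ->
    exists pi_ : nat -> probability (borel (X * X)%type) R,
      [/\ forall n, OptPlans (d_ n) mu nu (pi_ n),
          exists2 phi : nat -> nat, {homo phi : i j / (i < j)%N} &
            weakly_cvg (fun n => pi_ (phi n)) (Pi mu nu) &
          forall (n : nat) (t : I01 R),
            (Ent m (push (pi_ n) (e_ t \o G)) <=
              (1 - \val t)%:E * Ent m mu + (\val t)%:E * Ent m nu
              - (K / 2 * \val t * (1 - \val t))%:E * W2sq (d_ n) mu nu)%E]) ->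
  very_strict_CD (@mdist R X) m K.
Proof.
move=> [_ _ _ [x0 [c [c0 mexp']]]] _ d_dist d_metrizes d_cvg [H d_le] Gflow Glip _
  selection approximation mu0 mu1 mu0ac mu1ac.
have mexp : (\int[m]_(x in [set: borel X]) (expR (- (c * sqdist x0 x)))%:E < +oo)%E.
  by under eq_integral do rewrite -mulNr.
have mG : measurable_fun [set: borel (X * X)%type]
    (G : borel (X * X)%type -> borel (C01 R X)) by have [] := Gflow.
have GGeo p : Geo (@mdist R X) (G p).
  by case: p => x y; have [_ /(_ x y)[]] := Gflow.
have [eta etaE] := exists_push_probability (Pi mu0 mu1) mG.
exists eta.
  split.
    exists (~` Geo (@mdist R X)); split => //.
      by apply: measurableC; exact: measurable_Geo.
    rewrite etaE /push /pushforward (_ : G @^-1` _ = set0) ?measure0//.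
    by apply/seteqP; split => p //=; have := GGeo p.
  have -> : push eta (fun g : C01 R X => (e_ I01_0 g, e_ I01_1 g)) =
      (Pi mu0 mu1 : set (borel (X * X)%type) -> \bar R).
    apply/funext => A; rewrite {1}/push /pushforward etaE /push /pushforward.
    congr (Pi mu0 mu1 _); apply/seteqP; split => -[x y] /=;
      by have [_ /(_ x y)[_ -> ->]] := Gflow.
  exact: selection.1.
move=> t0 t1 t01 f mf f0 [M fM] f1 sigma sigma_ t.
pose fG (p : borel (X * X)%type) : R := f (G p).
have mfG : measurable_fun [set: borel (X * X)%type] fG.
  apply: (@measurable_comp _ _ _ _ _ _ (Geo (@mdist R X) : set (borel (C01 R X)))
    f _ (G : borel (X * X)%type -> borel (C01 R X))) => //.
  - exact: measurable_Geo.
  - by move=> _ [p _ <-]; exact: GGeo.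
have fG0 p : 0 <= fG p by exact: f0.
have fGM p : fG p <= M by exact: fM.
have weightedE (A : set (borel (C01 R X))) : measurable A ->
    weighted eta (Geo (@mdist R X)) f A =
    weighted (Pi mu0 mu1) [set: borel (X * X)%type] fG (G @^-1` A).
  move=> mA; have mAG : measurable (A `&` Geo (@mdist R X)).
    by apply: measurableI => //; exact: measurable_Geo.
  rewrite /weighted (same_measure_integral (nu := push (Pi mu0 mu1) G)); last first.
    by move=> B _; exact: etaE.
  rewrite ge0_integral_pushforward//.
  - congr (integral _ _ _); rewrite setIT; apply/seteqP; split => p /=.
      by case.
    by move=> Ap; split => //; exact: GGeo.
  - apply/measurable_EFinP; apply: measurable_funS mf; first exact: measurable_Geo.
    exact: subIsetr.
  - by move=> g; rewrite inE => -[_ Gg]; rewrite lee_fin f0.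
have fG1 : (\int[Pi mu0 mu1]_(p in [set: borel (X * X)%type]) (fG p)%:E = 1)%E.
  have := weightedE setT measurableT.
  by rewrite /weighted setTI f1 preimage_setT setTI => ->.
have sigmaE r : same_measure (sigma_ r)
   (push (weighted (Pi mu0 mu1) [set: borel (X * X)%type] fG)
     (e_ (affine t0 t1 r) \o G)).
  move=> A mA; rewrite /sigma_ /sigma /push /pushforward weightedE//.
  rewrite -[X in measurable X]setTI.
  have me : measurable_fun [set: borel (C01 R X)]
      (e_ (affine t0 t1 r) : borel (C01 R X) -> borel X).
    by apply: continuous_borel_measurable; exact: evaluation_continuous.
  exact: me.
have s0 := sigmaE I01_0; rewrite affine_0 in s0.
have s1 := sigmaE I01_1; rewrite affine_1 in s1.
rewrite (eq_Ent _ (sigmaE t)) (eq_Ent _ s0) (eq_Ent _ s1) (eq_W2sq _ s0 s1).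
exact: (restricted_entropy_convexity c0 mexp d_dist d_metrizes d_cvg d_le Gflow
  Glip selection approximation mu0ac mu1ac t01 mfG fG0 fGM fG1).
Qed.
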